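(* Assume the Lipschitz-Hessian condition, the IEO consistency conditions and the IEO regularity conditions (listed in the context). Let $\lambda_1\ge\dots\ge\lambda_q\ge0$ be the eigenvalues of $\frac12M_1^{IEO}\nabla_{\theta\theta}v_0(w_{\theta^*})M_1^{IEO}$. Then there is $D^{IEO}_{n,q}$, independent of $t$, such that for all $t>0$, $$\big|\mathbb P\big(nv_0(\hat w^{IEO})-nv_0(w_{\theta^*})\ge t\big)-\mathbb P(\mathbb G^{IEO}\ge t)\big|\le D^{IEO}_{n,q},$$ where, when $q=1$, $$D^{IEO}_{n,1}\lesssim\frac1{\sqrt{\lambda_1}}L_1^{1/2}\|M_1^{IEO}\|^{3/2}(\log n)^{3/4}n^{-1/4}+C^{IEO}_{n,1},$$ and when $q\ge2$, $$D^{IEO}_{n,q}\lesssim C^{IEO}_{n,q}+\Big(\Big(\sum_{i=1}^q\lambda_i^2\Big)\Big(\sum_{i=2}^q\lambda_i^2\Big)\Big)^{-1/4}L_1\|M_1^{IEO}\|^3q^{3/2}(\log n)^{3/2}n^{-1/2}.$$ Here $\lesssim$ hides constants independent of $n$ and $q$.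
   Context: Setup. $\Omega\subset\mathbb R^p$ and $\Theta\subset\mathbb R^q$ are open, $\mathcal Z\subset\mathbb R^d$, $c:\Omega\times\mathcal Z\to\mathbb R$ is a known cost function, $P$ is the (unknown) true distribution of a random vector $z\in\mathcal Z$, and $\{P_\theta:\theta\in\Theta\}$ is a parametric family of distributions on $\mathcal Z$; $P$ need not belong to the family. $v_0(w):=\mathbb E_P[c(w,z)]$. For $\theta\in\Theta$, $w_\theta\in\arg\min_{w\in\Omega}\mathbb E_{P_\theta}[c(w,z)]$. The data $z_1,\dots,z_n$ are i.i.d. from $P$. $\hat\theta^{IEO}$ minimizes $\hat v_0(w_\theta):=\frac1n\sum_{i=1}^n c(w_\theta,z_i)$ over $\Theta$, $\hat w^{IEO}:=w_{\hat\theta^{IEO}}$, $\theta^*:=\arg\min_{\theta\in\Theta}v_0(w_\theta)$; all optimizers are assumed to exist. Notation. Gradients are row vectors. $\nabla_{\theta\theta}v_0(w_{\theta'})$ is the Hessian of $\theta\mapsto v_0(w_\theta)$ at $\theta'$; $\nabla_\theta c(w_{\theta'},z)$ is the gradient of $\theta\mapsto c(w_\theta,z)$ at $\theta'$. $\|\cdot\|$ is the Euclidean/spectral norm; for a random vector $X$, $\|X\|_r:=(\mathbb E\|X\|^r)^{1/r}$. $A\le B$ for symmetric matrices means $B-A$ is positive semidefinite; $(\cdot)^{1/2}$ is the positive semidefinite square root. $Y_0\sim N(0,I_q)$, $M_1^{IEO}:=\big(\nabla_{\theta\theta}v_0(w_{\theta^*})^{-1}\mathrm{var}_P(\nabla_\theta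 c(w_{\theta^*},z))\nabla_{\theta\theta}v_0(w_{\theta^*})^{-1}\big)^{1/2}$ ($\mathrm{var}_P$ = covariance under $P$), $\mathbb G^{IEO}:=\frac12Y_0^\top M_1^{IEO}\nabla_{\theta\theta}v_0(w_{\theta^*})M_1^{IEO}Y_0$. Lipschitz-Hessian condition: $\Theta$ is bounded and $\|\nabla_{\theta\theta}v_0(w_{\theta_1})-\nabla_{\theta\theta}v_0(w_{\theta_2})\|\le L_1\|\theta_1-\theta_2\|$ for all $\theta_1,\theta_2\in\Theta$. IEO consistency conditions: $\sup_{\theta\in\Theta}|\hat v_0(w_\theta)-v_0(w_\theta)|\xrightarrow{P}0$; for all $\varepsilon>0$, $\inf_{\theta\in\Theta:\|\theta-\theta^*\|\ge\varepsilon}v_0(w_\theta)>v_0(w_{\theta^*})$. IEO regularity conditions: with $m(\theta,z)=c(w_\theta,z)$ and $\bar\theta=\theta^*$, $m(\cdot,z)$ is twice differentiable in $\theta$, and there are constants $\mu,c_1,c_2,c_4,\underline\lambda_1,\underline\lambda_2>0$, $c_3\ge0$ and nonnegative functions $K_1,K_2,K_3$ on $\mathcal Z$ with $\|K_1(z)\|_9\le c_1$, $\|K_2(z)\|_4\le c_2$, $\|K_3(z)\|_4\le c_3$ such that for all $\theta\in\Theta$, $z\in\mathcal Z$: $\mathbb E_P[m(\theta,z)]-\mathbb E_P[m(\bar\theta,z)]\ge\mu\|\theta-\bar\theta\|^2$; $|m(\theta,z)-m(\bar\theta,z)|\le K_1(z)\|\theta-\bar\theta\|$; $\|\nabla_{\theta\theta}m(\theta,z)-\nabla_{\theta\theta}m(\bar\theta,z)\|\le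 K_2(z)\|\theta-\bar\theta\|$; $\nabla_{\theta\theta}m(\bar\theta,z)\le K_3(z)I$; $\lambda_{\min}(\mathbb E_P[\nabla_\theta m(\bar\theta,z)^\top\nabla_\theta m(\bar\theta,z)])\ge\underline\lambda_1$; $\lambda_{\min}(\nabla_{\theta\theta}\mathbb E_P[m(\bar\theta,z)])\ge\underline\lambda_2$; $\|\nabla_\theta m(\bar\theta,z)\|_4\le c_4\sqrt q$. Berry–Esseen error term: $C^{IEO}_{n,q}:=C^{IEO}q^{9/4}n^{-1/2}$, where $C^{IEO}$ is a constant depending only on $c_1,\dots,c_4,\mu,\underline\lambda_1,\underline\lambda_2$ such that $|\mathbb P(\sqrt n(\hat\theta^{IEO}-\theta^* )\in A)-\mathbb P(M_1^{IEO}Y_0\in A)|\le C^{IEO}_{n,q}$ for all $n$ and all convex $A\subset\mathbb R^q$. *)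

(* Defs.v *)
From HB Require Import structures.
From mathcomp Require Import all_boot all_order all_algebra.
From mathcomp Require Import all_classical all_reals all_analysis.

Set Implicit Arguments.
Unset Strict Implicit.
Unset Printing Implicit Defensive.
Import Order.TTheory GRing.Theory Num.Theory.
Import numFieldNormedType.Exports.
Local Open Scope classical_set_scope.
Local Open Scope ring_scope.

Section LinearAlgebra.
Variable R : realType.

(* The norm the library puts on matrices is the sup norm, hence the separate
   Euclidean and spectral norms. *)
Definition enorm n (x : 'cV[R]_n) : R := Num.sqrt (\sum_i x i 0 ^+ 2).

Definition opnorm m n (A : 'M[R]_(m, n)) : R :=
  sup [set enorm (A *m x) | x in [set x : 'cV[R]_n | enorm x <= 1]].

Definition qform n (A : 'M[R]_n) (x : 'cV[R]_n) : R := (x^T *m A *m x) 0 0.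

Definition psd n (A : 'M[R]_n) : Prop := A^T = A /\ forall x, 0 <= qform A x.

Definition loewner_le n (A B : 'M[R]_n) : Prop := psd (B - A).

Definition is_psd_sqrt n (M S : 'M[R]_n) : Prop := psd M /\ M *m M = S.

(* Only used on symmetric matrices, whose eigenvalues are all real. *)
Definition lambda_min n (A : 'M[R]_n) : R := inf [set a | eigenvalue A a].

(* [lam] lists the eigenvalues of [A] with multiplicity, in decreasing order;
   the i-th largest one (counting from 1) is [lam`_i.-1]. *)
Definition is_spectrum n (A : 'M[R]_n) (lam : seq R) : Prop :=
  [/\ size lam = n, sorted >=%R lam &
      char_poly A = \prod_(a <- lam) ('X - a%:P)].

Definition grad n (f : 'cV[R]_n -> R) (x : 'cV[R]_n) : 'rV[R]_n :=
  \row_j 'D_(delta_mx j 0) f x.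

Definition hess n (f : 'cV[R]_n -> R) (x : 'cV[R]_n) : 'M[R]_n :=
  \matrix_(i, j) 'D_(delta_mx j 0) (fun y => grad f y 0 i) x.

(* Meant for open [D]. *)
Definition twice_differentiable_on n (D : set 'cV[R]_n) (f : 'cV[R]_n -> R) :=
  forall x, D x -> differentiable f x /\ differentiable (grad f) x.

End LinearAlgebra.

Section Borel.
Variable R : realType.

Definition borel n := g_sigma_algebraType (@open 'cV[R]_n).

(* A nonempty subset of R^n as a type, pointed at one of its elements since
   measurable types are pointed. *)
Definition pointed_subset n (Z : set 'cV[R]_n) (z0 : Z) : Type := set_type Z.

HB.instance Definition _ n (Z : set 'cV[R]_n) (z0 : Z) :=
  gen_eqMixin (pointed_subset z0).
HB.instance Definition _ n (Z : set 'cV[R]_n) (z0 : Z) :=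
  gen_choiceMixin (pointed_subset z0).
HB.instance Definition _ n (Z : set 'cV[R]_n) (z0 : Z) :=
  isPointed.Build (pointed_subset z0) z0.

(* The traces of Borel sets already form a sigma-algebra; generating it again
   only serves to obtain the measurable type. *)
Definition borel_on n (Z : set 'cV[R]_n) (z0 : Z) :=
  g_sigma_algebraType (preimage_set_system setT
    (fun z : pointed_subset z0 => set_val z : borel n) measurable).

End Borel.

Section Probability.
Variable R : realType.

Definition second_moment d (T : measurableType d) (P : probability T R) q
    (g : T -> 'rV[R]_q) : 'M[R]_q :=
  \matrix_(i, j) fine 'E_P[fun z => g z 0 i * g z 0 j].

Definition cov_mx d (T : measurableType d) (P : probability T R) q
    (g : T -> 'rV[R]_q) : 'M[R]_q :=
  \matrix_(i, j) fine (covariance P (fun z => g z 0 i) (fun z => g z 0 j)).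

Definition iid d dZ (T : measurableType d) (Z : measurableType dZ)
    (Pr : probability T R) (P : probability Z R) (z : nat -> T -> Z) : Prop :=
  (forall i, measurable_fun setT (z i)) /\
  forall n (B : nat -> set Z), (forall i, measurable (B i)) ->
    fine (Pr [set w | forall i, (i < n)%N -> B i (z i w)]) =
    \prod_(i < n) fine (P (B i)).

(* N(0, I_q) as the law of q independent standard normal coordinates. *)
Definition std_gaussian d (T : measurableType d) (Pr : probability T R) q
    (Y : T -> 'cV[R]_q) : Prop :=
  measurable_fun setT (Y : T -> borel R q) /\
  forall B : 'I_q -> set R, (forall i, measurable (B i)) ->
    fine (Pr [set w | forall i, B i (Y w i 0)]) =
    \prod_i fine (normal_prob 0 1 (B i)).

End Probability.

Section Setting.
Variables (R : realType) (p q : nat) (dZ : measure_display)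
  (Z : measurableType dZ).
Implicit Types (Omega : set 'cV[R]_p) (Theta : set 'cV[R]_q)
  (c : 'cV[R]_p -> Z -> R) (w : 'cV[R]_q -> 'cV[R]_p)
  (m : 'cV[R]_q -> Z -> R).

Definition expected_cost (P : probability Z R) c (x : 'cV[R]_p) : R :=
  fine 'E_P[c x].

Definition empirical_cost d (T : measurableType d) (z : nat -> T -> Z) c
    (n : nat) (x : 'cV[R]_p) (om : T) : R :=
  n%:R^-1 * \sum_(i < n) c x (z i om).

Definition argmin_on (T : Type) (D : set T) (f : T -> \bar R) (x : T) : Prop :=
  D x /\ forall y, D y -> (f x <= f y)%E.

Definition lipschitz_hessian Theta (f : 'cV[R]_q -> R) (L1 : R) : Prop :=
  [/\ bounded_set Theta, twice_differentiable_on Theta f &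
      forall t1 t2, Theta t1 -> Theta t2 ->
        opnorm (hess f t1 - hess f t2) <= L1 * enorm (t1 - t2)].

(* [f] is the population objective, [fhat n om] the empirical one. *)
Definition consistency d (T : measurableType d) (Pr : probability T R) Theta
    (fhat : nat -> T -> 'cV[R]_q -> R) (f : 'cV[R]_q -> R)
    (tstar : 'cV[R]_q) : Prop :=
  (forall eps : R, 0 < eps ->
     Pr [set om | (eps%:E <
           ereal_sup [set (`|fhat n om t - f t|)%:E | t in Theta])%E]
       @[n --> \oo] --> 0%E) /\
  (forall eps : R, 0 < eps ->
     ((f tstar)%:E <
       ereal_inf [set (f t)%:E | t in
         [set t | Theta t /\ (eps <= enorm (t - tstar))%R]])%E).

Definition regularity (P : probability Z R) Theta m (tbar : 'cV[R]_q)
    (mu c1 c2 c3 c4 l1 l2 : R) : Prop :=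
  [/\ [/\ 0 < mu, 0 < c1, 0 < c2, 0 <= c3 & [/\ 0 < c4, 0 < l1 & 0 < l2]],
      forall z, twice_differentiable_on Theta (m ^~ z),
      exists K1 K2 K3 : Z -> R,
        [/\ [/\ measurable_fun setT K1, measurable_fun setT K2 &
                measurable_fun setT K3],
            forall z, [/\ 0 <= K1 z, 0 <= K2 z & 0 <= K3 z],
            [/\ (Lnorm P 9%:E (EFin \o K1) <= c1%:E)%E,
                (Lnorm P 4%:E (EFin \o K2) <= c2%:E)%E &
                (Lnorm P 4%:E (EFin \o K3) <= c3%:E)%E] &
            forall t z, Theta t ->
              [/\ `|m t z - m tbar z| <= K1 z * enorm (t - tbar),
                  opnorm (hess (m ^~ z) t - hess (m ^~ z) tbar)
                    <= K2 z * enorm (t - tbar) &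
                  loewner_le (hess (m ^~ z) tbar) (K3 z)%:M]],
      forall t, Theta t ->
        mu * enorm (t - tbar) ^+ 2 <= fine 'E_P[m t] - fine 'E_P[m tbar] &
      [/\ l1 <= lambda_min (second_moment P (fun z => grad (m ^~ z) tbar)),
          l2 <= lambda_min (hess (fun t => fine 'E_P[m t]) tbar) &
          (Lnorm P 4%:E (fun z => (enorm (grad (m ^~ z) tbar)^T)%:E)
             <= (c4 * Num.sqrt q%:R)%:E)%E]].

End Setting.

Definition be_error (R : realType) (C : R) (n q : nat) : R :=
  C * q%:R `^ (9 / 4) * n%:R `^ (- (1 / 2)).

(* Only Borel convex sets are considered: in dimension at least 2 a convex set
   need not be Borel, and the two events could then fail to be measurable. *)
Definition berry_esseen (R : realType) q d d' (T : measurableType d)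
    (T' : measurableType d') (Pr : probability T R) (Pr' : probability T' R)
    (that : nat -> T -> 'cV[R]_q) (tstar : 'cV[R]_q) (M : 'M[R]_q)
    (Y : T' -> 'cV[R]_q) (C : R) : Prop :=
  forall n (A : set 'cV[R]_q), (0 < n)%N ->
    measurable (A : set (borel R q)) ->
    convex_set (A : set (convex_lmodType 'cV[R]_q)) ->
    `|fine (Pr [set om | A (Num.sqrt n%:R *: (that n om - tstar))])
      - fine (Pr' [set om | A (M *m Y om)])| <= be_error C n q.

(* Main.v *)
(* Write x = sqrt n (that - tstar) and Q x = x^T H x / 2. The regularity
   conditions give, with constants that involve neither L1 nor the dimension,
   the expansion v0 (w (tstar + v)) = v0 (w tstar) + Q v + O(|v|^3) near tstar
   and the growth v0 (w t) - v0 (w tstar) >= mu |t - tstar|^2. Hence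
   {n v0 (w that) - n v0 (w tstar) < t} lies between the convex events
   {Q x < t (1 - delta)} and {Q x < t (1 + delta)} with delta of order
   sqrt (t / n), and Berry-Esseen replaces x by M1 Y0, so that Q x becomes G.
   What remains is the Gaussian mass of the shell |G - t| <= delta t. Since G is
   homogeneous, this mass is the difference between the measures of a set and
   of its dilate; rescaling the q coordinates one at a time bounds it by a
   multiple of q^(9/4) n^(-1/2). The anticoncentration terms of the informal
   statement are thus not needed: the whole bound is a multiple of be_error,
   the multiple depending on 1 / CIEO. A constant CIEO = 0 is possible only if
   M1 = 0, in which case both probabilities vanish. *)
Require Import Defs.
From mathcomp Require Import all_boot all_order all_algebra.
From mathcomp Require Import all_classical all_reals all_analysis.
From mathcomp Require Import measurable_realfun ring lra.
Import Order.TTheory GRing.Theory Num.Theory.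
Import numFieldNormedType.Exports.
Local Open Scope classical_set_scope.
Local Open Scope ring_scope.

Set Implicit Arguments.
Unset Strict Implicit.

(** * Borel sets of euclidean space *)

(** The constant [K] is fixed before [L1], [q] and the laws, so the Taylor remainder of the
    population objective must not be measured by [L1]; what is controlled is the variation of the
    pathwise Hessians, through [K2]. Transferring that control directly would mean differentiating
    under the expectation. Third differences avoid it: being finite combinations of values they
    commute with the expectation, and as their step tends to 0 they converge to the Taylor
    remainder. [L1] enters only the error that vanishes in this limit.

    The other obstacle is uniformity in t. The shell has relative width of order sqrt (t / n), so a
    mass bound proportional to the width alone would grow with t. The dilation estimate gains a
    factor sqrt B, where B bounds the mass of the partially dilated events. Here B is of order
    q^(5/2) / t, so t cancels, and q coordinate steps times q^(5/4) give q^(9/4). Above a level of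
    order n the expansion is out of reach, but there the Gaussian tail is already small enough. *)

Lemma measurable_forall_ord d (T : measurableType d) q (A : 'I_q -> set T) :
  (forall i, measurable (A i)) -> measurable [set x | forall i, A i x].
Proof.
move=> mA; rewrite [X in measurable X](_ : _ = \bigcap_(i in setT) A i).
  exact: fin_bigcap_measurable.
by apply/seteqP; split=> [x Ax i _|x Ax i]; exact: Ax.
Qed.

(** An open set is a countable union of boxes with rational centre and radius [n.+1%:R^-1], and the
    preimage of a box is a finite intersection of coordinate conditions. The arbitrary sigma-algebra
    on the domain allows [f] to be the identity for the sigma-algebra generated by rectangles. *)
Lemma coord_preimage_open_measurable (R : realType) d (T : measurableType d) q
    (f : T -> 'cV[R]_q) (U : set 'cV[R]_q) :
  (forall i, measurable_fun setT (fun x => f x i 0)) -> open U ->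
  measurable (f @^-1` U).
Proof.
move=> mf oU.
pose I := ('M[rat]_(q, 1) * nat)%type.
pose box (k : I) : set 'cV[R]_q :=
  [set y | forall i, `|ratr (k.1 i 0) - y i 0| < k.2.+1%:R^-1].
have -> : f @^-1` U = \bigcup_(k : I)
    (if `[< box k `<=` U >] then f @^-1` (box k) else set0).
  apply/seteqP; split=> [x Ux|x [k _]]; last by case: asboolP => // kU; exact: kU.
  have /nbhs_ballP[e /= e0 eU] : nbhs (f x) U by exact: open_nbhs_nbhs.
  have [n ne] : exists n, n.+1%:R^-1 < e / 2.
    have e2 : 0 < e / 2 by rewrite divr_gt0.
    have := near_infty_natSinv_lt (PosNum e2) => -[n _ /(_ n (leqnn n)) /= h].
    by exists n.
  have n0 : 0 < n.+1%:R^-1 :> R by rewrite invr_gt0.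
  have /choice[g gP] (i : 'I_q) : exists c : rat, `|ratr c - f x i 0| < n.+1%:R^-1.
    have [|c] := @rat_in_itvoo R (f x i 0) (f x i 0 + n.+1%:R^-1).
      by rewrite ltrDl.
    rewrite in_itv/= => /andP[c1 c2]; exists c.
    by rewrite ger0_norm ?subr_ge0 ?ltW// ltrBlDl.
  exists (\matrix_(i, j) g i, n) => //=.
  case: asboolP => [_ i /=|]; first by rewrite mxE.
  apply; move=> y ky; apply: eU; split => // i j; rewrite ord1 /ball/=.
  have := ky i; rewrite /= mxE => {}ky; have {}gP := gP i.
  rewrite [ltRHS](splitr e).
  rewrite -[X in `|X|](subrKA (ratr (g i))) (le_lt_trans (ler_normD _ _))//.
  by rewrite ltrD// ?(distrC (f x i 0)); apply: lt_trans ne.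
apply: countable_bigcupT_measurable; first exact: countableP.
move=> k; case: asboolP => // _.
apply: measurable_forall_ord => i.
rewrite [X in measurable X](_ : _ = (fun x => ratr (k.1 i 0) - f x i 0) @^-1`
  ball 0 (k.2.+1%:R^-1 : R)).
  rewrite -[X in measurable X]setTI; apply: measurable_funB => //; last exact: measurable_ball.

by apply/seteqP; split=> x /=; rewrite /ball/= sub0r normrN.
Qed.

Lemma measurable_borelP (R : realType) d (T : measurableType d) q
    (f : T -> borel R q) :
  (forall i, measurable_fun setT (fun x => f x i 0)) <->
  measurable_fun setT f.
Proof.
split=> [mf|mf i].
  apply: (@measurability _ _ T (borel R q) setT f (@open _)) => //.
  by move=> _ [U oU <-]; rewrite setTI; exact: coord_preimage_open_measurable.
apply: (measurability _ (RGenOpens.measurableE R)).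
move=> _ [_ [a [b ->]] <-]; rewrite setTI.
suff : measurable ((fun y : borel R q => y i 0) @^-1` `]a, b[).
  by move=> /(mf measurableT); rewrite setTI.
apply: sub_sigma_algebra; apply: open_comp; last exact: interval_open.
by move=> y _; exact: coord_continuous.
Qed.

(** * The one-dimensional Gaussian *)

(** The pushforward under scaling, multiplied by [s], takes the right values on half-open intervals,
    which determine Lebesgue measure. *)
Lemma lebesgue_measure_scale (R : realType) (s : R) (D : set R) :
  0 < s -> measurable D ->
  lebesgue_measure D = (s%:E * lebesgue_measure ( *%R s @^-1` D))%E.
Proof.
move=> s0 mD; pose sn : {nonneg R} := NngNum (ltW s0).
have ms : measurable_fun setT ( *%R s : measurableTypeR R -> measurableTypeR R).
  exact: mulrl_measurable.
pose nu := mscale sn (pushforward (@lebesgue_measure R)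
  ( *%R s : measurableTypeR R -> measurableTypeR R)).
rewrite -[RHS]/(nu ms D).
apply: lebesgue_measure_unique => //= _ [[a b]] _ <-.
rewrite /mscale/= /pushforward.
have -> : *%R s @^-1` `]a, b] = `]a / s, b / s]%classic.
  apply/seteqP; split => x/=; rewrite !in_itv/=;
    by rewrite ltr_pdivrMr// ler_pdivlMr// (mulrC x).
rewrite !lebesgue_measure_itv/= !lte_fin ltr_pM2r ?invr_gt0//.
case: ifPn => ab; last by rewrite mule0.
by rewrite -EFinB -EFinM; congr (_%:E); field; rewrite gt_eqF.
Qed.

(** Change of variables [x = s * u]. A dilated set is traded for a Gaussian of standard deviation
    [s], so that dilations can be compared through densities. *)
Lemma normal_prob_scale (R : realType) (s : R) (D : set R) :
  0 < s -> measurable D ->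
  normal_prob 0 1 ( *%R s @^-1` D) = normal_prob 0 s D.
Proof.
move=> s0 mD; pose sn : {nonneg R} := NngNum (ltW s0).
have ms : measurable_fun setT ( *%R s : measurableTypeR R -> measurableTypeR R).
  exact: mulrl_measurable.
rewrite /normal_prob.
pose nu := mscale sn (pushforward (@lebesgue_measure R)
  ( *%R s : measurableTypeR R -> measurableTypeR R)).
transitivity (\int[nu ms]_(x in D) (normal_pdf 0 s x)%:E)%E; last first.
  apply: eq_measure_integral => A mA _ /=; apply/esym.
  exact: lebesgue_measure_scale.
have mp (t : R) E : measurable_fun E (fun x => (normal_pdf 0 t x)%:E).
  by apply/measurable_EFinP/measurable_funTS; exact: measurable_normal_pdf.
have p0 (t : R) x : (0 <= (normal_pdf 0 t x)%:E)%E.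
  by rewrite lee_fin normal_pdf_ge0.
rewrite ge0_integral_mscale//=; last exact: mp.
rewrite [X in (_ * X)%E](_ : _ = \int[lebesgue_measure]_(x in *%R s @^-1` D)
  (normal_pdf 0 s (s * x))%:E)%E; last first.
  have := @ge0_integral_pushforward _ _ _ _ _ _ ms (@lebesgue_measure R) D
     (fun x => (normal_pdf 0 s x)%:E) mD (mp s D).
  by apply => y _; exact: p0.
have mD' : measurable ( *%R s @^-1` D).
  by rewrite -[X in measurable X]setTI; exact: ms.
rewrite -ge0_integralZl//=; last 2 first.
  apply: measurable_funTS; apply/measurable_EFinP; apply: measurableT_comp;
    [exact: measurable_normal_pdf|exact: mulrl_measurable].
  by rewrite lee_fin ltW.
apply: eq_integral => x _; rewrite -EFinM !normal_pdfE ?oner_eq0 ?gt_eqF//.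
congr (_%:E); rewrite /normal_peak /normal_fun !subr0 mulrA; congr (_ * _).
  rewrite expr1n mul1r -mulrnAr sqrtrM ?sqr_ge0// sqrtr_sqr gtr0_norm//.
  by rewrite invfM mulrA divff ?mul1r ?gt_eqF.
congr expR; field; rewrite gt_eqF//.
Qed.

(** The ratio of the two densities is [Num.sqrt 2 * expR (- x ^+ 2 / 4)], and
    [expR y >= (y / 2) ^+ 2] gives [x ^+ 4 <= 64 * expR (x ^+ 2 / 4)]. Fourth moments over a set
    thus become probabilities. *)
Lemma normal_pdf_quartic_le (R : realType) (x : R) :
  x ^+ 4 * normal_pdf 0 1 x <= 128 * normal_pdf 0 (Num.sqrt 2) x.
Proof.
have s20 : Num.sqrt 2 != 0 :> R by rewrite sqrtr_eq0 -ltNge.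
have pi0 : 0 < pi :> R := pi_gt0 R.
rewrite !normal_pdfE ?oner_eq0// /normal_peak /normal_fun !subr0.
rewrite expr1n mul1r sqr_sqrtr//.
have -> : 2 * pi *+ 2 = 2 * (pi *+ 2) :> R by ring.
rewrite sqrtrM// invfM; set p := (Num.sqrt (pi *+ 2))^-1.
have p0 : 0 <= p by rewrite invr_ge0 sqrtr_ge0.
have -> : - x ^+ 2 / (2 *+ 2) = (x ^+ 2 / 4 + - x ^+ 2 / (1 *+ 2)) :> R.
  by field.
rewrite expRD; set y := x ^+ 2 / 4; set e := expR (- x ^+ 2 / _).
have y0 : 0 <= y by rewrite divr_ge0 ?sqr_ge0.
have xE : x ^+ 4 <= 64 * expR y.
  have -> : expR y = expR (y / 2) ^+ 2 by rewrite -expRM_natl; congr expR; field.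
  have -> : x ^+ 4 = 16 * y ^+ 2 by rewrite /y; field.
  have := expR_ge1Dx (y / 2); nra.
have r2 : Num.sqrt 2 <= 2 :> R.
  by have := sqr_sqrtr (ler0n R 2); have := sqrtr_ge0 (2 : R); nra.
have pe : 0 <= p * e by rewrite mulr_ge0// expR_ge0.
have r2' : 1 <= 2 * (Num.sqrt 2)^-1 :> R.
  by rewrite ler_pdivlMr ?mul1r// sqrtr_gt0.
rewrite [leRHS](_ : _ = (2 * (Num.sqrt 2)^-1) * (64 * expR y) * (p * e)); last by ring.
by rewrite ler_wpM2r// (le_trans xE)// ler_peMl// mulr_ge0// expR_ge0.
Qed.

(** With [k = (s ^- 2 - 1) / 2 * x ^+ 2], the density of standard deviation [s] is
    [s^-1 * expR (- k)] times the standard one, and this factor is at least [1 - k]. *)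
Lemma normal_pdf_scale_le (R : realType) (s x : R) : 0 < s -> s <= 1 ->
  normal_pdf 0 1 x <= normal_pdf 0 s x
     + (s ^- 2 - 1) / 2 * x ^+ 2 * normal_pdf 0 1 x.
Proof.
move=> s0 s1; rewrite !normal_pdfE ?oner_eq0 ?gt_eqF//.
have pi0 : 0 < pi :> R := pi_gt0 R.
rewrite /normal_peak /normal_fun !subr0.
rewrite expr1n mul1r -mulrnAr sqrtrM ?sqr_ge0// sqrtr_sqr gtr0_norm// invfM.
set p := (Num.sqrt (pi *+ 2))^-1.
have p0 : 0 <= p by rewrite invr_ge0 sqrtr_ge0.
have -> : - x ^+ 2 / (s ^+ 2 *+ 2) =
    - ((s ^- 2 - 1) / 2 * x ^+ 2) + - x ^+ 2 / (1 *+ 2) :> R.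
  by field; rewrite gt_eqF.
rewrite expRD; set k := _ / 2 * _; set e := expR (- x ^+ 2 / _).
have e0 : 0 <= p * e by rewrite mulr_ge0// expR_ge0.
have k1 : 1 - k <= s^-1 * expR (- k).
  apply: le_trans (expR_ge1Dx _) _; rewrite ler_peMl ?expR_ge0//.
  by rewrite invf_ge1.
rewrite [X in _ <= X + _](_ : _ = (s^-1 * expR (- k)) * (p * e)); last by ring.
by rewrite -mulrDl ler_peMl// -lerBlDr.
Qed.

Lemma normal_prob_le_comb (R : realType) (D : set R) (a b c s t u : R) :
  measurable D -> 0 <= a -> 0 <= b -> 0 <= c ->
  (forall x, D x -> normal_pdf 0 1 x <= a * normal_pdf 0 s x
     + b * normal_pdf 0 t x + c * normal_pdf 0 u x) ->
  fine (normal_prob 0 1 D) <= a * fine (normal_prob 0 s D)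
    + b * fine (normal_prob 0 t D) + c * fine (normal_prob 0 u D).
Proof.
move=> mD a0 b0 c0 h.
have fin m r : normal_prob m r D \is a fin_num by exact: fin_num_measure.
have mp (k r : R) E : measurable_fun E (fun x => (k * normal_pdf 0 r x)%:E).
  apply/measurable_EFinP/measurable_funTS.
  by apply: measurable_funM => //; exact: measurable_normal_pdf.
have p0 (k r : R) x : 0 <= k -> (0 <= (k * normal_pdf 0 r x)%:E)%E.
  by move=> ?; rewrite lee_fin mulr_ge0// normal_pdf_ge0.
have pZ (k r : R) : 0 <= k -> (k%:E * normal_prob 0 r D =
    \int[lebesgue_measure]_(x in D) (k * normal_pdf 0 r x)%:E)%E.
  move=> k0; rewrite /normal_prob; under [RHS]eq_integral do rewrite EFinM.
  rewrite ge0_integralZl//.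
  by apply/measurable_EFinP/measurable_funTS; exact: measurable_normal_pdf.
  by move=> x _; rewrite lee_fin normal_pdf_ge0.
rewrite -lee_fin !EFinD !EFinM !fineK// !pZ//.
rewrite -ge0_integralD//; try by [move=> x _; exact: p0|exact: mp].
rewrite -ge0_integralD//; try by [move=> x _; rewrite ?adde_ge0// p0
  |exact: mp|apply: emeasurable_funD; exact: mp].
apply: ge0_le_integral => //.
- by move=> x _; rewrite lee_fin normal_pdf_ge0.
- by apply/measurable_EFinP/measurable_funTS; exact: measurable_normal_pdf.
- by apply: emeasurable_funD; [apply: emeasurable_funD|]; exact: mp.
Qed.

Lemma fine_probability_le1 (R : realType) d (T : measurableType d)
    (P : probability T R) (A : set T) : measurable A -> fine (P A) <= 1.
Proof.
by move=> mA; rewrite -lee_fin fineK ?fin_num_measure// probability_le1.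
Qed.

(* AM-GM turns the second moment over [D] into a fourth moment and a measure. *)
Lemma normal_prob_scale_le (R : realType) (s a : R) (D : set R) :
  0 < s -> s <= 1 -> 0 < a -> measurable D ->
  fine (normal_prob 0 1 D) <= fine (normal_prob 0 1 ( *%R s @^-1` D))
    + (s ^- 2 - 1) / 4 * (128 * a + fine (normal_prob 0 1 D) / a).
Proof.
move=> s0 s1 a0 mD; rewrite normal_prob_scale//.
have k0 : 0 <= (s ^- 2 - 1) / 4 :> R.
  by rewrite divr_ge0// subr_ge0 invf_ge1 ?exprn_gt0// exprn_ile1// ltW.
set k := (s ^- 2 - 1) / 4 in k0 *.
have := @normal_prob_le_comb R D 1 (k * a * 128) (k / a) s (Num.sqrt 2) 1 mD.
rewrite mul1r => /(_ ler01) h.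
apply: le_trans (h _ _ _) _.
- exact: mulr_ge0 (mulr_ge0 k0 (ltW a0)) (ler0n _ _).
- exact: divr_ge0 k0 (ltW a0).
- move=> x _; rewrite mul1r.
  apply: le_trans (normal_pdf_scale_le x s0 s1) _.
  rewrite -addrA lerD2l; have := normal_pdf_quartic_le x.
  move=> /(ler_wpM2l (mulr_ge0 k0 (ltW a0))).
  rewrite [X in _ <= X -> _]mulrA => q.
  apply: le_trans (lerD q (lexx _)).
  have -> : (s ^- 2 - 1) / 2 = k * 2 by rewrite /k; field; rewrite gt_eqF.
  set f := normal_pdf 0 1 x; have f0 : 0 <= f by exact: normal_pdf_ge0.
  rewrite -subr_ge0 [leRHS](_ : _ = k * f * (a * (x ^+ 2 - a^-1) ^+ 2)).
    by apply: mulr_ge0; [exact: mulr_ge0|rewrite mulr_ge0 ?sqr_ge0// ltW].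
  by field; rewrite gt_eqF.
have := fine_probability_le1 (normal_prob 0 (Num.sqrt 2)) mD.
set u := fine _; set v := fine _; set w := fine _ => u1.
have ka0 : 0 <= k * a by exact: mulr_ge0 k0 (ltW a0).
rewrite -addrA lerD2l.
have -> : k * (128 * a + w / a) = k * a * 128 + k / a * w by ring.
by rewrite lerD2r ler_piMr// mulr_ge0.
Qed.

(** Markov's inequality for the fourth power, with 128 standing in for the fourth moment. *)
Lemma normal_prob_tail_le (R : realType) (v : R) : 0 < v ->
  fine (normal_prob 0 1 [set x | v <= x ^+ 2]) <= 128 / v ^+ 2.
Proof.
move=> v0; have mD : measurable [set x : R | v <= x ^+ 2].
  rewrite -[X in measurable X]setTI [X in _ `&` X](_ : _ =
    (fun x : R => x ^+ 2) @^-1` `[v, +oo[).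
    by apply: exprn_measurable => //; exact: measurable_itv.
  by apply/seteqP; split => x /=; rewrite in_itv/= andbT.
have v20 : 0 < v ^+ 2 by rewrite exprn_gt0.
have := @normal_prob_le_comb R _ 0 (128 / v ^+ 2) 0 1 (Num.sqrt 2) 1 mD (lexx 0).
rewrite !mul0r add0r addr0 => h; apply: le_trans (h _ (lexx 0) _) _.
- by rewrite divr_ge0// ltW.
- move=> x /= vx; rewrite !mul0r add0r addr0.
  rewrite mulrAC ler_pdivlMr// mulrC; apply: le_trans (normal_pdf_quartic_le x).
  rewrite ler_wpM2r ?normal_pdf_ge0//.
  by rewrite -[4%N]/(2 * 2)%N exprM lerXn2r ?nnegrE ?sqr_ge0// ltW.
by rewrite ler_piMr ?fine_probability_le1// divr_ge0// ltW.
Qed.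

Lemma normal_prob_unit_itv_gt0 (R : realType) (a : R) :
  0 < fine (normal_prob 0 1 `[a, a + 1]).
Proof.
have fin : normal_prob 0 1 `[a, a + 1] \is a fin_num by exact: fin_num_measure.
pose b := `|a| + 1.
rewrite -lte_fin fineK//.
apply: (@lt_le_trans _ _ (normal_pdf 0 1 b)%:E).
  rewrite lte_fin normal_pdfE ?oner_eq0// mulr_gt0 ?expR_gt0//.
  by rewrite normal_peak_gt0// oner_eq0.
have -> : (normal_pdf 0 1 b)%:E =
    (\int[lebesgue_measure]_(x in `[a, (a + 1)%R]) (normal_pdf 0 1 b)%:E)%E.
  rewrite integral_cst//= lebesgue_measure_itv/= lte_fin ltrDl ltr01.
  by rewrite -EFinB addrAC subrr add0r mule1.
apply: ge0_le_integral => //.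
- by move=> x _; rewrite lee_fin normal_pdf_ge0.
- by apply/measurable_EFinP/measurable_funTS; exact: measurable_normal_pdf.
- move=> x /=; rewrite in_itv/= => /andP[ax xa]; rewrite lee_fin.
  rewrite !normal_pdfE ?oner_eq0// ler_wpM2l ?normal_peak_ge0//.
  rewrite ler_expR !subr0 ler_pM2r ?invr_gt0 ?expr1n// lerN2.
  have : `|x| <= b.
    rewrite ler_norml /b; have := ler_norm a; have := ler_norm (- a).
    by rewrite normrN => ? ?; apply/andP; split; lra.
  by rewrite ler_norml => /andP[? ?]; nra.
Qed.

(** * Standard Gaussian vectors *)

Definition resample (R : realType) q (k : 'I_q) (u : R) (y : 'cV[R]_q) :
    'cV[R]_q := \col_i (if i == k then u else y i 0).

Lemma measurable_resample (R : realType) d d' (T : measurableType d)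
    (T' : measurableType d') q (k : 'I_q) (f : T -> R) (g : T' -> borel R q) :
  measurable_fun setT f -> measurable_fun setT g ->
  measurable_fun setT
    (fun x : T' * T => resample k (f x.2) (g x.1) : borel R q).
Proof.
move=> mf /measurable_borelP mg; apply/measurable_borelP => i.
have [ik|ik] := boolP (i == k).
  rewrite (_ : (fun _ => _) = f \o snd); first exact: measurableT_comp.
  by apply/funext => x; rewrite /resample mxE ik.
rewrite (_ : (fun _ => _) = (fun x => g x i 0) \o fst).
  by apply: measurableT_comp => //; exact: mg.
by apply/funext => x; rewrite /resample mxE (negbTE ik).
Qed.

(** Replacing coordinate [k] by an independent standard normal leaves the law of [Y] unchanged; this
    serves as conditioning on the other coordinates. Since [std_gaussian] speaks of rectangles only,
    the proof goes through uniqueness of measures on a generating pi-system. *)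
Lemma std_gaussian_resample (R : realType) d (T : measurableType d)
    (Pr : probability T R) q (Y : T -> 'cV[R]_q) (k : 'I_q)
    (A : set (borel R q)) :
  std_gaussian Pr Y -> measurable A ->
  Pr (Y @^-1` A) =
  (\int[Pr]_x normal_prob 0 1 [set u | A (resample k u (Y x))])%E.
Proof.
move=> [mY rectY] mA.
have mYi i : measurable_fun setT (fun x => Y x i 0).
  by move: i; apply/measurable_borelP.
have mr : measurable_fun setT (fun x : T * measurableTypeR R =>
    resample k x.2 (Y x.1) : borel R q).
  by apply: (@measurable_resample _ _ _ (measurableTypeR R) T q k id Y).
have PrE (B : 'I_q -> set R) : (forall i, measurable (B i)) ->
    Pr [set w | forall i, B i (Y w i 0)] =
    (\prod_i fine (normal_prob 0 1 (B i)))%:E.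
  move=> mB; rewrite -rectY// fineK// fin_num_measure//.
  apply: measurable_forall_ord => i.
  by rewrite -[X in measurable X]setTI; exact: mYi.
pose m1 := [the {measure set (borel R q) -> \bar R} of
  pushforward Pr (Y : T -> borel R q)].
pose m2 := [the {measure set (borel R q) -> \bar R} of
  pushforward (Pr \x normal_prob 0 1)%E
  (fun x : T * measurableTypeR R => resample k x.2 (Y x.1) : borel R q)].
transitivity (m2 mr A); last first.
  apply: eq_integral => x _ /=; congr (normal_prob 0 1 _).
  by apply/seteqP; split=> u; rewrite /xsection/= in_setE.
rewrite -[LHS]/(m1 mY A).
pose G : set (set (borel R q)) := [set C | exists2 B : 'I_q -> set R,
  forall i, measurable (B i) & C = [set y : 'cV[R]_q | forall i, B i (y i 0)]].
apply: (measure_unique G (fun _ => setT)) => //.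
(* Rectangles generate the Borel sets: an open set is its own preimage under the identity, whose
   coordinates are measurable for the sigma-algebra generated by rectangles. *)
- apply/seteqP; split=> C.
    apply: smallest_sub; first exact: smallest_sigma_algebra.
    move=> U oU; rewrite -[U]/(id @^-1` U).
    apply: (@coord_preimage_open_measurable R _ (g_sigma_algebraType G) q id) => //.
    move=> i _ B mB; rewrite setTI; apply: sub_sigma_algebra.
    exists (fun j => if j == i then B else setT).
      by move=> j; case: ifP.
    apply/seteqP; split => y /= => [Bi j|/(_ i)]; last by rewrite eqxx.
    by case: eqP => // ->.
  apply: smallest_sub; first exact: sigma_algebra_measurable.
  move=> _ [B mB ->]; apply: measurable_forall_ord => i.
  rewrite -[X in measurable X]setTI.
  have /measurable_borelP/(_ i) := @measurable_id _ (borel R q) setT.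
  exact.
- move=> _ _ [B1 mB1 ->] [B2 mB2 ->].
  exists (fun i => B1 i `&` B2 i); first by move=> i; exact: measurableI.
  apply/seteqP; split=> y /=; first by move=> [b1 b2] i.
  by move=> b; split=> i; have [] := b i.
- by move=> _; exists (fun=> setT) => //; apply/seteqP; split.
- by rewrite bigcup_const.
- move=> _ [B mB ->]; rewrite /m1 /m2 /= /pushforward.
  rewrite [LHS](PrE B mB).
  (* The resampled vector lies in the rectangle when [Y] meets the constraints other than the [k]-th
     and the fresh coordinate meets that one: a product event. *)
  pose B' i := if i == k then setT else B i.
  have mB' i : measurable (B' i) by rewrite /B'; case: ifP.
  have -> : (fun x : T * measurableTypeR R => resample k x.2 (Y x.1)) @^-1`
      [set y : 'cV[R]_q | forall i, B i (y i 0)] =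
      [set w | forall i, B' i (Y w i 0)] `*` B k.
    apply/seteqP; split => -[x u] /=.
      move=> h; split; last by have := h k; rewrite /resample mxE eqxx.
      move=> i; have := h i; rewrite /B' /resample mxE.
      by case: ifP.
    move=> [h1 h2] i; have := h1 i; rewrite /B' /resample mxE.
    by case: eqP => [->|].
  have mC : measurable [set w | forall i, B' i (Y w i 0)].
    apply: measurable_forall_ord => i.
    by rewrite -[X in measurable X]setTI; exact: mYi.
  have mBk : measurable (B k : set (measurableTypeR R)) by exact: mB.
  have E := @product_measure1E _ _ T (measurableTypeR R) R Pr (normal_prob 0 1) _ _ mC mBk.
  apply/esym; apply: (etrans E); apply/esym.
  transitivity ((\prod_i fine (normal_prob 0 1 (B' i)))%:E
    * normal_prob 0 1 (B k))%E; last by congr (_ * _)%E; apply/esym/PrE.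
  rewrite (bigD1 k)//= [in RHS](bigD1 k)//=.
  rewrite {1}/B' eqxx probability_setT/= mul1r.
  have Bfin : normal_prob 0 1 (B k) \is a fin_num by apply: fin_num_measure; exact: mB.
  rewrite -[X in (_ * X)%E]fineK// -EFinM mulrC.
  congr ((_ * _)%:E); apply: eq_bigr => i ik.
  by rewrite /B' (negbTE ik).
- by move=> ?; rewrite /m1/= /pushforward preimage_setT probability_setT ltry.
Qed.

Lemma measurable_resample_section (R : realType) q (k : 'I_q)
    (y : 'cV[R]_q) (A : set (borel R q)) :
  measurable A -> measurable [set u | A (resample k u y)].
Proof.
move=> mA; rewrite -[X in measurable X]setTI.
suff : measurable_fun setT (fun u : R => resample k u y : borel R q) by exact.
apply/measurable_borelP => i; have [ik|ik] := boolP (i == k).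
  rewrite (_ : (fun _ => _) = id); first exact: measurable_id.
  by apply/funext => x; rewrite /resample mxE ik.
rewrite (_ : (fun _ => _) = cst (y i 0)); first exact: measurable_cst.
by apply/funext => x; rewrite /resample mxE (negbTE ik).
Qed.

Lemma measurable_fun_resample_prob (R : realType) d (T : measurableType d) q
    (Y : T -> borel R q) (k : 'I_q) (A : set (borel R q)) :
  measurable_fun setT Y -> measurable A ->
  measurable_fun setT
    (fun x => normal_prob 0 1 [set u | A (resample k u (Y x))]).
Proof.
move=> mY mA.
have mr : measurable_fun setT (fun x : T * measurableTypeR R =>
    resample k x.2 (Y x.1) : borel R q).
  by apply: (@measurable_resample _ _ _ (measurableTypeR R) T q k id Y).
have mrA := mr measurableT _ mA; rewrite setTI in mrA.
have := @measurable_fun_xsection _ _ T (measurableTypeR R) R (normal_prob 0 1) _ mrA.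
apply: eq_measurable_fun => x _ /=; congr (normal_prob 0 1 _).
by apply/seteqP; split=> u; rewrite /xsection/= in_setE.
Qed.

(** Interpolates between [y] at [k = 0] and [s *: y] at [k = q], one coordinate at a time. *)
Definition shrink (R : realType) q (s : R) (k : nat) (y : 'cV[R]_q) :
    'cV[R]_q := \col_i (if (i < k)%N then s * y i 0 else y i 0).

Lemma measurable_shrink (R : realType) q (s : R) (k : nat) :
  measurable_fun setT (shrink s k : borel R q -> borel R q).
Proof.
apply/measurable_borelP => i.
have /measurable_borelP/(_ i) mi := @measurable_id _ (borel R q) setT.
have [ik|ik] := boolP (i < k)%N.
  rewrite (_ : (fun _ => _) = *%R s \o (fun y : borel R q => y i 0)).
    by apply: measurableT_comp => //; exact: mulrl_measurable.
  by apply/funext => x; rewrite /shrink mxE ik.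
rewrite (_ : (fun _ => _) = (fun y : borel R q => y i 0)); first exact: mi.
by apply/funext => x; rewrite /shrink mxE (negbTE ik).
Qed.

(** The one-dimensional estimate is applied to the section along coordinate [k] and integrated over
    the others. The section probabilities average to the probability of the unshrunk event, which
    therefore reappears in the error term. *)
Lemma std_gaussian_shrink_step (R : realType) d (T : measurableType d)
    (Pr : probability T R) q (Y : T -> 'cV[R]_q) (k : 'I_q)
    (A : set (borel R q)) (s a : R) :
  std_gaussian Pr Y -> measurable A -> 0 < s -> s <= 1 -> 0 < a ->
  fine (Pr [set w | A (shrink s k (Y w))]) <=
  fine (Pr [set w | A (shrink s k.+1 (Y w))])
  + (s ^- 2 - 1) / 4 * (128 * a + fine (Pr [set w | A (shrink s k (Y w))]) / a).
Proof.
move=> gY mA s0 s1 a0; have mY := gY.1.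
have mAk j : measurable (shrink s j @^-1` A : set (borel R q)).
  by rewrite -[X in measurable X]setTI; exact: measurable_shrink.
have mP (B : set (borel R q)) : measurable B -> measurable (Y @^-1` B).
  by move=> mB; rewrite -[X in measurable X]setTI; exact: mY.
have PE j : Pr [set w | A (shrink s j (Y w))] =
    (\int[Pr]_x normal_prob 0 1 [set u | A (shrink s j (resample k u (Y x)))])%E.
  exact: (std_gaussian_resample k gY (mAk j)).
set c := (s ^- 2 - 1) / 4.
have c0 : 0 <= c.
  by rewrite divr_ge0// subr_ge0 invf_ge1 ?exprn_gt0// exprn_ile1// ltW.
pose S j x : set R := [set u | A (shrink s j (resample k u (Y x)))].
have mS j x : measurable (S j x).
  exact: (measurable_resample_section k (Y x) (mAk j)).
have mNS j : measurable_fun setT (fun x => normal_prob 0 1 (S j x)).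
  exact: (measurable_fun_resample_prob k mY (mAk j)).
(* Coordinate [k] is the only one on which the two shrinkings differ, and it is the resampled
   one. *)
have Sk x : S k.+1 x = *%R s @^-1` S k x.
  suff E u : shrink s k.+1 (resample k u (Y x)) = shrink s k (resample k (s * u) (Y x)).
    by apply/seteqP; split=> u; rewrite /S/= E.
  apply/matrixP => i j; rewrite /shrink /resample !mxE ltnS.
  by case: ltngtP (eqVneq i k) => [ik|ik|/val_inj ik] []//; 
    [move=> ik'; rewrite ik' ltnn in ik|move=> ik'; rewrite ik' ltnn in ik|
     move=> /eqP].
have fin j x : normal_prob 0 1 (S j x) \is a fin_num.
  by apply: fin_num_measure; exact: mS.
have Pfin j : Pr [set w | A (shrink s j (Y w))] \is a fin_num.
  by apply: fin_num_measure; exact: (mP _ (mAk j)).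
have pE j : (fine (Pr [set w | A (shrink s j (Y w))]))%:E =
    (\int[Pr]_x normal_prob 0 1 (S j x))%E by rewrite fineK// PE.
have -> r t : t + c * (128 * a + r / a) = t + (c * (128 * a) + c / a * r).
  by ring.
rewrite -lee_fin 2!EFinD [((_ / a) * _)%:E]EFinM !pE.
have N0 j x : (0 <= normal_prob 0 1 (S j x))%E by exact: measure_ge0.
apply: (@le_trans _ _ (\int[Pr]_x (normal_prob 0 1 (S k.+1 x) +
   ((c * (128 * a))%:E + (c / a)%:E * normal_prob 0 1 (S k x))))%E).
  apply: ge0_le_integral => //.
  - apply: emeasurable_funD; first exact: mNS.
    apply: emeasurable_funD => //; apply: emeasurable_funM => //; exact: mNS.
  - move=> x _; rewrite -(fineK (fin k x)) -(fineK (fin k.+1 x)) -EFinM -!EFinD.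
    rewrite lee_fin Sk; apply: le_trans (normal_prob_scale_le s0 s1 a0 (mS k x)) _.
    rewrite lerD2l -/c; set v := fine _.
    by rewrite [leRHS](_ : _ = c * (128 * a + v / a)) //; ring.
have ca0 : 0 <= c / a by exact: divr_ge0 c0 (ltW a0).
have K0 : 0 <= c * (128 * a) by apply: mulr_ge0 c0 _; rewrite mulr_ge0// ltW.
rewrite ge0_integralD//; last 2 first.
- by move=> x _; rewrite adde_ge0 ?mule_ge0// lee_fin.
- apply: emeasurable_funD => //; apply: emeasurable_funM => //; exact: mNS.
rewrite leeD2l// ge0_integralD//; last 2 first.
- by move=> x _; rewrite mule_ge0// lee_fin.
- apply: emeasurable_funM => //; exact: mNS.
rewrite integral_cst//= probability_setT mule1 ge0_integralZl//.
Qed.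

Lemma fine_probability_ge0 (R : realType) d (T : measurableType d)
    (P : probability T R) (A : set T) : 0 <= fine (P A).
Proof. by rewrite fine_ge0. Qed.

Lemma le_fine_probability (R : realType) d (T : measurableType d)
    (P : probability T R) (A B : set T) : measurable A -> measurable B ->
  A `<=` B -> fine (P A) <= fine (P B).
Proof.
move=> mA mB AB; rewrite fine_le ?fin_num_measure//.
by rewrite le_measure// inE.
Qed.

Lemma measurable_exists_ord d (T : measurableType d) q (A : 'I_q -> set T) :
  (forall i, measurable (A i)) -> measurable [set x | exists i, A i x].
Proof.
move=> mA; rewrite [X in measurable X](_ : _ = \bigcup_(i in setT) A i).
  exact: fin_bigcup_measurable.
by apply/seteqP; split=> [w [i iw]|w [i _ iw]]; exists i.
Qed.

Lemma fine_probability_exists_le (R : realType) d (T : measurableType d)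
    (P : probability T R) q (A : 'I_q -> set T) :
  (forall i, measurable (A i)) ->
  fine (P [set x | exists i, A i x]) <= \sum_i fine (P (A i)).
Proof.
move=> mA; have -> : [set x | exists i, A i x] = \big[setU/set0]_(i < q) A i.
  rewrite -bigcup_seq; apply/seteqP; split=> [w [i iw]|w [i _ iw]]; exists i => //=.
  by rewrite mem_index_enum.
suff : measurable (\big[setU/set0]_(i < q) A i) /\
    fine (P (\big[setU/set0]_(i < q) A i)) <= \sum_i fine (P (A i)) by case.
apply: (big_rec2 (fun U s => measurable U /\ fine (P U) <= s)).
  by split => //; rewrite measure0.
move=> i s U _ [mU Us]; split; first exact: measurableU.
apply: le_trans (lerD (lexx _) Us).
rewrite -fineD ?fin_num_measure// fine_le ?fin_numD ?fin_num_measure//.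
  exact: measurableU.
exact: measureU2.
Qed.

(** Telescoping over the [q] coordinates. The common bound [B] on the intermediate events is what
    makes the loss proportional to [Num.sqrt B], hence small for rare events. *)
Lemma std_gaussian_dilation (R : realType) d (T : measurableType d)
    (Pr : probability T R) q (Y : T -> 'cV[R]_q) (A : set (borel R q))
    (s B : R) :
  std_gaussian Pr Y -> measurable A -> 0 < s -> s <= 1 -> 0 < B ->
  (forall k, fine (Pr [set w | A (shrink s k (Y w))]) <= B) ->
  fine (Pr [set w | A (Y w)]) <= fine (Pr [set w | A (s *: Y w)])
    + 6 * q%:R * (s ^- 2 - 1) * Num.sqrt B.
Proof.
move=> gY mA s0 s1 B0 leB.
set c := 6 * (s ^- 2 - 1) * Num.sqrt B.
have sB0 : 0 < Num.sqrt B by rewrite sqrtr_gt0.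
have k0 : 0 <= (s ^- 2 - 1) / 4.
  by rewrite divr_ge0// subr_ge0 invf_ge1 ?exprn_gt0// exprn_ile1// ltW.
have step (k : 'I_q) : fine (Pr [set w | A (shrink s k (Y w))]) <=
    fine (Pr [set w | A (shrink s k.+1 (Y w))]) + c.
  (* This choice of [a] makes both [128 * a] and [B / a] multiples of [Num.sqrt B], namely 16 and 8
     times; the constant 6 is their sum divided by 4. *)
  have a0 : 0 < Num.sqrt B / 8 by rewrite divr_gt0.
  apply: le_trans (std_gaussian_shrink_step k gY mA s0 s1 a0) _.
  rewrite lerD2l.
  have -> : c = (s ^- 2 - 1) / 4 * (128 * (Num.sqrt B / 8) + Num.sqrt B * 8).
    by rewrite /c; field; rewrite gt_eqF.
  rewrite ler_wpM2l// lerD2l invfM invrK mulrA ler_pM2r//.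
  by rewrite ler_pdivrMr// -expr2 sqr_sqrtr// ltW.
have shrink0 y : shrink s 0 y = y :> 'cV[R]_q.
  by apply/matrixP => i j; rewrite mxE ord1.
have shrinkq y : shrink s q y = s *: y :> 'cV[R]_q.
  by apply/matrixP => i j; rewrite !mxE ltn_ord ord1.
have main k : (k <= q)%N -> fine (Pr [set w | A (shrink s 0 (Y w))]) <=
    fine (Pr [set w | A (shrink s k (Y w))]) + k%:R * c.
  elim: k => [|k IH kq]; first by rewrite mul0r addr0.
  apply: le_trans (IH (ltnW kq)) _.
  rewrite -natr1 mulrDl mul1r [in leRHS](addrC _ c) addrA lerD2r.
  exact: (step (Ordinal kq)).
have := main q (leqnn q); under eq_set do rewrite shrink0.
under [in X in _ <= X -> _]eq_set do rewrite shrinkq.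
by rewrite /c; set p := fine _; set p' := fine _; nra.
Qed.

Lemma std_gaussian_coord (R : realType) d (T : measurableType d)
    (Pr : probability T R) q (Y : T -> 'cV[R]_q) (i : 'I_q) (B : set R) :
  std_gaussian Pr Y -> measurable B ->
  fine (Pr [set w | B (Y w i 0)]) = fine (normal_prob 0 1 B).
Proof.
move=> [_ rectY] mB.
have := rectY (fun j => if j == i then B else setT).
rewrite (bigD1 i)//= eqxx big1 ?mulr1; last first.
  by move=> j /negbTE ->; rewrite probability_setT.
move=> <-; last by move=> j; case: ifP.
congr (fine (Pr _)); apply/seteqP; split => w /= => [Bw j|/(_ i)].
  by case: eqP => // ->.
by rewrite eqxx.
Qed.

Lemma measurable_std_gaussian_preimage (R : realType) d (T : measurableType d)
    (Pr : probability T R) q (Y : T -> 'cV[R]_q) (A : set (borel R q)) :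
  std_gaussian Pr Y -> measurable A -> measurable [set w | A (Y w)].
Proof. by move=> [mY _] mA; rewrite -[X in measurable X]setTI; exact: mY. Qed.

Lemma measurable_borel_coord (R : realType) q (i : 'I_q) :
  measurable_fun setT (fun y : borel R q => y i 0).
Proof. by move: i; apply/measurable_borelP; exact: measurable_id. Qed.

Lemma measurable_borel_sumsq (R : realType) q :
  measurable_fun setT (fun y : borel R q => \sum_i y i 0 ^+ 2).
Proof.
apply: measurable_sum => i; apply: measurable_funX.
exact: measurable_borel_coord.
Qed.

Lemma measurable_ge (R : realType) d (T : measurableType d) (f : T -> R) (t : R) :
  measurable_fun setT f -> measurable [set x | t <= f x].
Proof.
move=> mf; rewrite [X in measurable X](_ : _ = setT `&` f @^-1` `[t, +oo[).
  by apply: mf => //; exact: measurable_itv.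
by apply/seteqP; split => x /=; rewrite in_itv/= andbT// => -[].
Qed.

(** Some coordinate has square at least [v / q%:R], so a union bound with the fourth-moment tail
    gives [128 * q%:R ^+ 3 / v ^+ 2]. Its square root is the claim. *)
Lemma std_gaussian_sumsq_tail (R : realType) d (T : measurableType d)
    (Pr : probability T R) q (Y : T -> 'cV[R]_q) (v : R) :
  std_gaussian Pr Y -> 0 < v -> (0 < q)%N ->
  fine (Pr [set w | v <= \sum_i (Y w i 0) ^+ 2]) <=
    12 * q%:R `^ (3 / 2) / v.
Proof.
move=> gY v0 q0; have q0' : 0 < q%:R :> R by rewrite ltr0n.
have mi i : measurable [set w | v / q%:R <= Y w i 0 ^+ 2].
  apply: (measurable_std_gaussian_preimage (A := [set y : borel R q | v / q%:R <= y i 0 ^+ 2]) gY).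
  by apply: measurable_ge; apply: measurable_funX; exact: measurable_borel_coord.
have mA : measurable [set w | v <= \sum_i (Y w i 0) ^+ 2].
  apply: (measurable_std_gaussian_preimage (A := [set y : borel R q | v <= \sum_i (y i 0) ^+ 2]) gY).
  by apply: measurable_ge; exact: measurable_borel_sumsq.
set p := fine _.
have p1 : p <= 1 by exact: fine_probability_le1.
have p0 : 0 <= p by exact: fine_probability_ge0.
have pq : p <= 128 * q%:R ^+ 3 / v ^+ 2.
  have v20 : 0 < v / q%:R by rewrite divr_gt0.
  have mt : measurable [set x : R | v / q%:R <= x ^+ 2].
    by apply: measurable_ge; apply: measurable_funX; exact: measurable_id.
  have ti i : fine (Pr [set w | v / q%:R <= Y w i 0 ^+ 2]) <=
      128 / (v / q%:R) ^+ 2.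
    rewrite (std_gaussian_coord i gY mt); exact: normal_prob_tail_le.
  apply: (@le_trans _ _ (fine (Pr [set w | exists i, v / q%:R <= Y w i 0 ^+ 2]))); last first.
    apply: le_trans (fine_probability_exists_le Pr mi) _.
    apply: le_trans (ler_sum _ (fun i _ => ti i)) _.
    rewrite sumr_const card_ord -[leLHS]mulr_natr.
    by rewrite le_eqVlt; apply/orP; left; apply/eqP; field; rewrite !gt_eqF.
  apply: le_fine_probability => //; first exact: (measurable_exists_ord mi).
    move=> w /= vY; apply: contrapT => h.
    have {}h i : Y w i 0 ^+ 2 < v / q%:R.
      by rewrite ltNge; apply/negP => h'; apply: h; exists i.
    have : \sum_i (Y w i 0) ^+ 2 < \sum_(i < q) v / q%:R.
      apply: ltr_sum => //; apply/hasP; exists (Ordinal q0) => //.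
    rewrite sumr_const card_ord -[X in _ < X -> _]mulr_natr divfK ?gt_eqF//.
    by rewrite ltNge vY.
set x := q%:R `^ (3 / 2).
have x0 : 0 <= x by exact: powR_ge0.
have xE : q%:R ^+ 3 = x ^+ 2.
  by rewrite /x -!powR_mulrn ?powR_ge0// -powRrM; congr (_ `^ _); field.
rewrite ler_pdivlMr//; rewrite ler_pdivlMr ?exprn_gt0// xE in pq.
(* A probability satisfies [p ^+ 2 <= p], which allows the square root to be taken; 12 exceeds the
   square root of 128. *)
have : (p * v) ^+ 2 <= 128 * x ^+ 2.
  apply: le_trans pq; rewrite exprMn ler_wpM2r ?sqr_ge0//.
  by rewrite expr2 ler_piMr.
have : 0 <= p * v by rewrite mulr_ge0// ltW.
by move: (p * v) => u; nra.
Qed.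

(* Since [G] is homogeneous of degree 2, the shell [t1 <= G < t2] is the
   difference between a set and its dilate. *)
Lemma std_gaussian_shell_le (R : realType) d (T : measurableType d)
    (Pr : probability T R) q (Y : T -> 'cV[R]_q) (G : borel R q -> R)
    (b t1 t2 : R) :
  std_gaussian Pr Y -> (0 < q)%N -> measurable_fun setT G ->
  (forall s y, G (s *: y) = s ^+ 2 * G y) ->
  0 < b -> (forall y, G y <= b * q%:R * \sum_i y i 0 ^+ 2) ->
  0 < t1 -> t1 <= t2 ->
  fine (Pr [set w | t1 <= G (Y w)]) <= fine (Pr [set w | t2 <= G (Y w)])
    + 6 * (t2 / t1 - 1) * Num.sqrt (12 * b / t1) * q%:R `^ (9 / 4).
Proof.
move=> gY q0 mG Gh b0 Gb t10 t12; have t20 : 0 < t2 by exact: lt_le_trans t12.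
have q0' : 0 < q%:R :> R by rewrite ltr0n.
pose s := Num.sqrt (t1 / t2).
have s0 : 0 < s by rewrite sqrtr_gt0 divr_gt0.
have s2 : s ^+ 2 = t1 / t2 by rewrite sqr_sqrtr// divr_ge0// ltW.
have s1 : s <= 1.
  by rewrite /s -[leRHS]sqrtr1 ler_wsqrtr// ler_pdivrMr// mul1r.
pose A : set (borel R q) := [set y | t1 <= G y].
have mA : measurable A by exact: measurable_ge.
(* Where [G] reaches [t1] the sum of squares reaches [v], and shrinking coordinates only lowers that
   sum, so one tail bound [B] covers all intermediate events. *)
pose v := t1 / (b * q%:R).
have v0 : 0 < v by rewrite divr_gt0// mulr_gt0.
pose B := 12 * q%:R `^ (3 / 2) / v.
have B0 : 0 < B by rewrite divr_gt0// mulr_gt0// powR_gt0.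
have AB k : fine (Pr [set w | A (shrink s k (Y w))]) <= B.
  apply: le_trans (std_gaussian_sumsq_tail gY v0 q0).
  apply: le_fine_probability.
  - apply: (measurable_std_gaussian_preimage gY (A := shrink s k @^-1` A)).
    by rewrite -[X in measurable X]setTI; exact: measurable_shrink.
  - apply: (measurable_std_gaussian_preimage (A := [set y : borel R q | v <= \sum_i (y i 0) ^+ 2]) gY).
    by apply: measurable_ge; exact: measurable_borel_sumsq.
  move=> w /= /le_trans/(_ (Gb _)) h.
  rewrite /v ler_pdivrMr ?mulr_gt0// mulrC; apply: le_trans h _.
  apply: ler_wpM2l; first by rewrite mulr_ge0// ltW.
  apply: ler_sum => i _; rewrite mxE.
  by case: ifP => // _; rewrite exprMn ler_piMl ?sqr_ge0// exprn_ile1// ltW.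
have := std_gaussian_dilation gY mA s0 s1 B0 AB.
rewrite (_ : [set w | A (s *: Y w)] = [set w | t2 <= G (Y w)]); last first.
  apply/seteqP; split=> w; rewrite /A /= Gh s2 mulrAC ler_pdivlMr// ler_pM2l//.
move=> /le_trans; apply; rewrite lerD2l.
rewrite -exprVn -invf_div; rewrite exprVn s2 invf_div.
rewrite -!mulrA ler_pM2l// [leLHS]mulrCA ler_wpM2l//.
  by rewrite subr_ge0 ler_pdivlMr// mul1r.
(* The tail contributes q^(3/2) and [v] a further factor q, so [Num.sqrt B] carries q^(5/4); the
   number of coordinate steps completes it to q^(9/4). *)
have -> : B = (12 * (b / t1)) * (q%:R `^ (5 / 4)) ^+ 2.
  rewrite /B /v -powR_mulrn ?powR_ge0// -powRrM.
  have -> : 5 / 4 * 2%:R = 3 / 2 + 1 :> R by field.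
  rewrite powRD ?implybE ?gt_eqF ?orbT// powRr1 ?ltW//.
  by field; rewrite !gt_eqF.
rewrite sqrtrM ?sqrtr_sqr; last by rewrite mulr_ge0// divr_ge0// ltW.
rewrite ger0_norm ?powR_ge0// mulrCA ler_wpM2l ?sqrtr_ge0//.
have -> : 9 / 4 = 1 + 5 / 4 :> R by field.
by rewrite powRD ?implybE ?gt_eqF ?orbT// powRr1 ?(ltW q0').
Qed.

Lemma measurable_borel_linear (R : realType) q (a : 'I_q -> R) :
  measurable_fun setT (fun y : borel R q => \sum_i a i * y i 0).
Proof.
apply: measurable_sum => i; apply: measurable_funM; first exact: measurable_cst.
exact: measurable_borel_coord.
Qed.

(** A box of unit intervals has positive probability, and it can be placed where the linear form
    exceeds [C]. *)
Lemma std_gaussian_linear_unbounded (R : realType) d (T : measurableType d)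
    (Pr : probability T R) q (Y : T -> 'cV[R]_q) (a : 'I_q -> R) (j : 'I_q)
    (C : R) :
  std_gaussian Pr Y -> a j != 0 ->
  fine (Pr [set w | \sum_i a i * Y w i 0 <= C]) < 1.
Proof.
move=> gY aj; have [_ rectY] := gY.
pose D := `|C| + 1.
have D0 : 0 < D by rewrite ltr_wpDl.
(* Left end of a unit interval on which [a i * y >= D]; for negative [a i] the interval has to end
   at [D / a i] instead of starting there. *)
pose e i := if 0 < a i then D / a i else if a i < 0 then D / a i - 1 else 0.
pose B i : set R := `[e i, e i + 1]%classic.
have mB i : measurable (B i) by exact: measurable_itv.
have aB i y : B i y -> (if a i == 0 then 0 else D) <= a i * y.
  rewrite /B /= in_itv/= /e; case: (ltgtP (a i) 0) => [a0|a0|->] /andP[h1 h2].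
  - rewrite subrK in h2.
    have := ler_wnM2l (ltW a0) h2.
    by rewrite mulrCA divff ?mulr1// lt_eqF.
  - have := ler_wpM2l (ltW a0) h1.
    by rewrite mulrCA divff ?mulr1// gt_eqF.
  - by rewrite mul0r.
have Bp : 0 < fine (Pr [set w | forall i, B i (Y w i 0)]).
  by rewrite rectY//; apply: prodr_gt0 => i _; exact: normal_prob_unit_itv_gt0.
have mA : measurable [set w | \sum_i a i * Y w i 0 <= C].
  apply: (measurable_std_gaussian_preimage (A := [set y : borel R q | \sum_i a i * y i 0 <= C]) gY).
  rewrite [X in measurable X](_ : _ = [set y : borel R q | - C <= - \sum_i a i * y i 0]).
    by apply: measurable_ge; apply: measurableT_comp => //; exact: measurable_borel_linear.
  by apply/seteqP; split => y /=; rewrite lerN2.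
have mR : measurable [set w | forall i, B i (Y w i 0)].
  apply: measurable_forall_ord => i.
  apply: (measurable_std_gaussian_preimage (A := [set y : borel R q | B i (y i 0)]) gY).
  rewrite -[X in measurable X]setTI.
  exact: (measurable_borel_coord (R := R) i).
have : fine (Pr [set w | forall i, B i (Y w i 0)]) <=
    fine (Pr (~` [set w | \sum_i a i * Y w i 0 <= C])).
  apply: le_fine_probability => //; first exact: measurableC.
  move=> w /= Bw; apply/negP; rewrite -ltNge.
  rewrite (bigD1 j)//=; have := aB j _ (Bw j); rewrite (negbTE aj) => h.
  have : 0 <= \sum_(i < q | i != j) a i * Y w i 0.
    apply: sumr_ge0 => i _; apply: le_trans (aB i _ (Bw i)).
    by case: ifP => // _; exact: ltW.
  have := ler_norm C; rewrite /D in h; lra.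
rewrite probability_setC// fineB ?fin_num_measure//= => h.
by have := lt_le_trans Bp h; rewrite subr_gt0.
Qed.

(** * Euclidean and spectral norms *)

(** [B * (A * B - C ^+ 2)] is the sum of the squares of [a i * B - b i * C]; if [B = 0], all [b i]
    vanish. *)
Lemma sum_cauchy_schwarz (R : realType) q (a b : 'I_q -> R) :
  (\sum_i a i * b i) ^+ 2 <= (\sum_i a i ^+ 2) * (\sum_i b i ^+ 2).
Proof.
set A := \sum_i a i ^+ 2; set B := \sum_i b i ^+ 2; set C := \sum_i a i * b i.
have B0 : 0 <= B by apply: sumr_ge0 => i _; exact: sqr_ge0.
have h : 0 <= B * (A * B - C ^+ 2).
  have -> : B * (A * B - C ^+ 2) = \sum_i (a i * B - b i * C) ^+ 2.
    transitivity (\sum_i (B ^+ 2 * a i ^+ 2 - 2 * B * C * (a i * b i) +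
        C ^+ 2 * b i ^+ 2)); last by apply: eq_bigr => i _; ring.
    rewrite big_split/= sumrB -!mulr_sumr -/A -/B -/C; ring.
  by apply: sumr_ge0 => i _; exact: sqr_ge0.
have [B00|] := eqVneq B 0; last first.
  by move=> Bn; rewrite -subr_ge0 -(pmulr_rge0 _ (_ : 0 < B))// lt_neqAle eq_sym Bn.
have b0 i : b i = 0.
  apply/eqP; rewrite -sqrf_eq0; apply/eqP.
  have /psumr_eq0P := B00; apply => // j _; exact: sqr_ge0.
by rewrite /C big1 ?expr0n ?mulr_ge0// => [|i _]; rewrite ?b0 ?mulr0// sumr_ge0// => i _; rewrite sqr_ge0.
Qed.

Section EuclideanNorm.
Variable R : realType.
Implicit Types q : nat.

Definition dot q (x y : 'cV[R]_q) : R := \sum_i x i 0 * y i 0.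

Lemma enorm_ge0 q (x : 'cV[R]_q) : 0 <= enorm x.
Proof. exact: sqrtr_ge0. Qed.

Lemma sqr_enorm q (x : 'cV[R]_q) : enorm x ^+ 2 = \sum_i x i 0 ^+ 2.
Proof. by rewrite sqr_sqrtr// sumr_ge0// => i _; exact: sqr_ge0. Qed.

Lemma normr_dot_le q (x y : 'cV[R]_q) : `|dot x y| <= enorm x * enorm y.
Proof.
rewrite -(@ler_pXn2r _ 2)// ?nnegrE ?mulr_ge0 ?enorm_ge0// exprMn !sqr_enorm.
by rewrite real_normK ?num_real// sum_cauchy_schwarz.
Qed.

Lemma enormZ q (s : R) (x : 'cV[R]_q) : enorm (s *: x) = `|s| * enorm x.
Proof.
rewrite /enorm -sqrtr_sqr -sqrtrM ?sqr_ge0// mulr_sumr; congr Num.sqrt.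
by apply: eq_bigr => i _; rewrite mxE exprMn.
Qed.

Lemma enorm_eq0 q (x : 'cV[R]_q) : enorm x = 0 -> x = 0.
Proof.
move=> x0; have := sqr_enorm x; rewrite x0 expr0n/= => /esym/psumr_eq0P h.
apply/matrixP => i j; rewrite ord1 mxE; apply/eqP; rewrite -sqrf_eq0; apply/eqP.
by apply: h => // k _; exact: sqr_ge0.
Qed.

Lemma enorm0 q : enorm (0 : 'cV[R]_q) = 0.
Proof. by rewrite -(scale0r 0) enormZ normr0 mul0r. Qed.

Lemma coord_le_enorm q (x : 'cV[R]_q) i : `|x i 0| <= enorm x.
Proof.
rewrite -sqrtr_sqr ler_wsqrtr// (bigD1 i)//= lerDl sumr_ge0// => j _.
exact: sqr_ge0.
Qed.

(** The Frobenius norm is an upper bound. Without this [sup] could be a default value, and [opnorm]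
    would say nothing. *)
Lemma has_sup_opnorm m n (A : 'M[R]_(m, n)) :
  has_sup [set enorm (A *m x) | x in [set x : 'cV[R]_n | enorm x <= 1]].
Proof.
split; first by exists (enorm (A *m 0)), 0 => //=; rewrite enorm0.
exists (Num.sqrt (\sum_i \sum_j A i j ^+ 2)) => _ [x /= x1 <-].
rewrite ler_wsqrtr//; apply: ler_sum => i _; rewrite mxE.
apply: le_trans (sum_cauchy_schwarz (A i) (x ^~ 0)) _.
rewrite ler_piMr ?sumr_ge0// => [j _|]; first exact: sqr_ge0.
by rewrite -sqr_enorm exprn_ile1// enorm_ge0.
Qed.

Lemma opnorm_ge0 m n (A : 'M[R]_(m, n)) : 0 <= opnorm A.
Proof.
apply: (@le_trans _ _ (enorm (A *m 0))); first exact: enorm_ge0.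
apply: sup_upper_bound; first exact: has_sup_opnorm.
by exists 0 => //=; rewrite enorm0.
Qed.

Lemma enorm_mulmx_le m n (A : 'M[R]_(m, n)) (x : 'cV[R]_n) :
  enorm (A *m x) <= opnorm A * enorm x.
Proof.
have [/enorm_eq0 ->|x0] := eqVneq (enorm x) 0.
  by rewrite mulmx0 !enorm0 mulr0.
have xp : 0 < enorm x by rewrite lt_neqAle eq_sym x0 enorm_ge0.
rewrite -ler_pdivrMr// mulrC -[X in X * _]gtr0_norm ?invr_gt0//.
rewrite -enormZ scalemxAr; apply: sup_upper_bound; first exact: has_sup_opnorm.
exists ((enorm x)^-1 *: x) => //=.
by rewrite enormZ gtr0_norm ?invr_gt0// mulVf.
Qed.

(** No symmetry of [A] is built in: a Hessian is here a matrix of iterated partial derivatives,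
    whose symmetry comes only with [hess_sym]. *)
Definition bform n (A : 'M[R]_n) (x y : 'cV[R]_n) : R := dot x (A *m y).

Lemma qformE n (A : 'M[R]_n) (x : 'cV[R]_n) : qform A x = bform A x x.
Proof.
rewrite /qform /bform /dot -mulmxA mxE; apply: eq_bigr => i _.
by rewrite mxE.
Qed.

Lemma normr_bform_le n (A : 'M[R]_n) (x y : 'cV[R]_n) :
  `|bform A x y| <= opnorm A * enorm x * enorm y.
Proof.
apply: le_trans (normr_dot_le _ _) _.
by rewrite (mulrC (opnorm A)) -mulrA ler_wpM2l ?enorm_ge0// enorm_mulmx_le.
Qed.

Lemma dotDl q (x y z : 'cV[R]_q) : dot (x + y) z = dot x z + dot y z.
Proof. by rewrite /dot -big_split; apply: eq_bigr => i _; rewrite mxE mulrDl. Qed.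

Lemma dotC q (x y : 'cV[R]_q) : dot x y = dot y x.
Proof. by apply: eq_bigr => i _; rewrite mulrC. Qed.

Lemma dotDr q (x y z : 'cV[R]_q) : dot z (x + y) = dot z x + dot z y.
Proof. by rewrite dotC dotDl !(dotC z). Qed.

Lemma dotZl q (s : R) (x y : 'cV[R]_q) : dot (s *: x) y = s * dot x y.
Proof. by rewrite /dot mulr_sumr; apply: eq_bigr => i _; rewrite mxE mulrA. Qed.

Lemma dotZr q (s : R) (x y : 'cV[R]_q) : dot x (s *: y) = s * dot x y.
Proof. by rewrite dotC dotZl dotC. Qed.

Lemma dotxx q (x : 'cV[R]_q) : dot x x = enorm x ^+ 2.
Proof. by rewrite sqr_enorm; apply: eq_bigr => i _; rewrite expr2. Qed.

Lemma bformE n (A : 'M[R]_n) x y :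
  bform A x y = \sum_i \sum_j x i 0 * A i j * y j 0.
Proof.
rewrite /bform /dot; apply: eq_bigr => i _; rewrite mxE mulr_sumr.
by apply: eq_bigr => j _; rewrite mulrA.
Qed.

Lemma qformZ n (A : 'M[R]_n) s x : qform A (s *: x) = s ^+ 2 * qform A x.
Proof. by rewrite !qformE /bform -scalemxAr dotZl dotZr mulrA expr2. Qed.

Lemma qformD n (A : 'M[R]_n) x y :
  qform A (x + y) = qform A x + qform A y + bform A x y + bform A y x.
Proof. by rewrite !qformE /bform mulmxDr !dotDr !dotDl; ring. Qed.

Lemma bformB n (A B : 'M[R]_n) x y :
  bform (A - B) x y = bform A x y - bform B x y.
Proof. by rewrite /bform mulmxBl -scaleN1r dotDr dotZr mulN1r. Qed.

Lemma enormD_le q (x y : 'cV[R]_q) : enorm (x + y) <= enorm x + enorm y.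
Proof.
rewrite -(@ler_pXn2r _ 2)// ?nnegrE ?addr_ge0 ?enorm_ge0//.
rewrite -!dotxx dotDl !dotDr (dotC y x) sqrrD -!dotxx.
have := le_trans (ler_norm _) (normr_dot_le x y); lra.
Qed.

End EuclideanNorm.

(** * Second-order Taylor expansions *)

Section Taylor.
Variable R : realType.

Lemma MVT01 (f df : R -> R) (b : R) : 0 < b ->
  (forall s, 0 <= s <= b -> is_derive s 1 f (df s)) ->
  exists2 c, 0 < c < b & f b - f 0 = df c * b.
Proof.
move=> b0 fd; have [s sb|x|c] := @MVT _ f df 0 b b0.
- by apply: fd; move: sb; rewrite in_itv/= => /andP[/ltW -> /ltW ->].
- apply: derivable_within_continuous => s; rewrite in_itv/= => sb.
  exact: (@ex_derive _ _ _ _ _ _ _ (fd s sb)).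
by rewrite in_itv/= subr0 => cb fE; exists c.
Qed.

(** The mean value theorem is used twice, on [f1] and then on [f] minus its quadratic part. An
    integral remainder would ask for more than the existence of [f2] and its control relative to
    0. *)
Lemma taylor2_real (f f1 f2 : R -> R) (K : R) :
  (forall s : R, 0 <= s <= 1 -> is_derive s 1 f (f1 s)) ->
  (forall s : R, 0 <= s <= 1 -> is_derive s 1 f1 (f2 s)) ->
  (forall s : R, 0 <= s <= 1 -> `|f2 s - f2 0| <= K * s) ->
  `|f 1 - f 0 - f1 0 - 2^-1 * f2 0| <= K.
Proof.
move=> df df1 Kf2.
have K0 : 0 <= K.
  by have := Kf2 1; rewrite ler01 lexx mulr1 => /(_ isT); exact: le_trans.
have f1K s : 0 < s -> s <= 1 -> `|f1 s - f1 0 - f2 0 * s| <= K.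
  move=> s0 s1; have [t /andP[t0 ts]|c /andP[c0 cs] ->] := @MVT01 f1 f2 s s0.
    by apply: df1; rewrite t0 (le_trans ts).
  rewrite -mulrBl normrM (gtr0_norm s0).
  have /= := Kf2 c; rewrite (ltW c0) (ltW (lt_le_trans cs s1)) => /(_ isT) h.
  apply: le_trans (_ : K * c * s <= _); first by rewrite ler_wpM2r// ltW.
  rewrite -mulrA ler_piMr// mulr_ile1// ?ltW//.
  by rewrite (lt_le_trans cs).
pose g s := f s - f1 0 * s - 2^-1 * f2 0 * s ^+ 2.
have [|s s01|c /andP[c0 c1]] := @MVT01 g (fun s => f1 s - f1 0 - f2 0 * s) 1.
- exact: ltr01.
- have dfs := df s s01; rewrite /g; apply: is_derive_eq.
  by rewrite /GRing.scale/=; field.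
rewrite mulr1 => gE.
have -> : f 1 - f 0 - f1 0 - 2^-1 * f2 0 = g 1 - g 0.
  by rewrite /g; ring.
by rewrite gE f1K// ltW.
Qed.

Variable q : nat.
Implicit Types (f : 'cV[R]_q -> R) (x v : 'cV[R]_q).

Lemma is_derive_line f x v s : differentiable f (x + s *: v) ->
  is_derive s 1 (fun s => f (x + s *: v)) (dot v (grad f (x + s *: v))^T).
Proof.
move=> df; have dv : derivable f (x + s *: v) v by exact: diff_derivable.
have E : (fun h : R => h^-1 *: (f (x + (h *: (1 : R) + s) *: v) - f (x + s *: v)))
    = (fun h => h^-1 *: (f (h *: v + (x + s *: v)) - f (x + s *: v))).
  apply/funext => h; congr (_ *: (f _ - _)).
  by rewrite [h *: 1]mulr1 scalerDl addrCA.
apply: DeriveDef; first by rewrite /derivable/= E.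
rewrite /derive/= E -[LHS]/('D_v f (x + s *: v)) deriveE//.
set a := x + s *: v in df *.
transitivity ('d f a (\sum_i v i 0 *: delta_mx i 0)).
  congr ('d f a _); rewrite [LHS]matrix_sum_delta; apply: eq_bigr => i _.
  by rewrite big_ord1.
rewrite linear_sum; apply: eq_bigr => i _.
by rewrite linearZ/= mxE mxE deriveE.
Qed.

Lemma differentiable_grad_coord f x i : differentiable (grad f) x ->
  differentiable (fun y => grad f y 0 i) x.
Proof.
move=> df.
by apply: (@differentiable_comp _ _ _ _ (grad f) (fun M : 'rV[R]_q => M 0 i)) => //;
  exact: differentiable_coord.
Qed.

Lemma is_derive_grad_line f x v u s :
  differentiable (grad f) (x + s *: v) ->
  is_derive s 1 (fun s => dot u (grad f (x + s *: v))^T)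
    (bform (hess f (x + s *: v)) u v).
Proof.
move=> df; rewrite /bform /dot.
have di i := is_derive_line (differentiable_grad_coord i df).
have H := is_derive_sum (fun i => is_deriveZ (u i 0) (di i)).
have E : (fun s => \sum_i u i 0 * (grad f (x + s *: v))^T i 0) =
    \sum_i (u i 0 \*: (fun s => grad f (x + s *: v) 0 i)).
  by apply/funext => t; rewrite fct_sumE; apply: eq_bigr => i _; rewrite mxE.
rewrite E; apply: is_derive_eq.
apply: eq_bigr => i _; rewrite /GRing.scale/= mxE; congr (_ * _).
by apply: eq_bigr => j _; rewrite !mxE mulrC.
Qed.

(** Restriction to the segment reduces this to one variable. The Hessian is compared only with its
    value at the base point, which is the form of the regularity condition on the cost. *)
Lemma taylor2 f x v (L : R) :
  (forall s : R, 0 <= s <= 1 -> differentiable f (x + s *: v) /\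
     differentiable (grad f) (x + s *: v)) ->
  (forall s : R, 0 <= s <= 1 ->
     opnorm (hess f (x + s *: v) - hess f x) <= L * (s * enorm v)) ->
  `|f (x + v) - f x - dot v (grad f x)^T - 2^-1 * qform (hess f x) v|
     <= L * enorm v ^+ 3.
Proof.
move=> df Lf.
have := @taylor2_real (fun s => f (x + s *: v))
  (fun s => dot v (grad f (x + s *: v))^T)
  (fun s => bform (hess f (x + s *: v)) v v) (L * enorm v ^+ 3).
rewrite /= scale1r !scale0r !addr0 -qformE; apply.
- by move=> s /df[? _]; exact: is_derive_line.
- by move=> s /df[_ ?]; exact: is_derive_grad_line.
move=> s s01; rewrite qformE -bformB.
apply: le_trans (normr_bform_le _ _ _) _.
apply: le_trans (_ : L * (s * enorm v) * enorm v * enorm v <= _).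
  by rewrite !ler_wpM2r ?enorm_ge0// Lf.
by rewrite le_eqVlt; apply/orP; left; apply/eqP; ring.
Qed.

End Taylor.

(** * Moment bounds and linear combinations of expectations *)

Section Moments.
Variables (R : realType) (d : measure_display) (T : measurableType d)
  (P : probability T R).

Lemma Lnorm4_le (X : T -> R) (c : R) : 0 <= c ->
  (Lnorm P 4%:E (EFin \o X) <= c%:E)%E ->
  (\int[P]_z (X z ^+ 4)%:E <= (c ^+ 4)%:E)%E.
Proof.
move=> c0 Xc; have E := @poweR_Lnorm _ _ R P (EFin \o X) 4.
have -> : (\int[P]_z (X z ^+ 4)%:E = Lnorm P 4%:E (EFin \o X) `^ 4)%E.
  rewrite E// ?pnatr_eq0//; apply: eq_integral => z _ /=.
  rewrite powR_mulrn ?normr_ge0//.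
  by rewrite -[4%N]/(2 * 2)%N !exprM real_normK// num_real.
have := Lnorm_ge0 P 4%:E (EFin \o X).
case: (Lnorm P 4%:E (EFin \o X)) Xc => [r|//|//]; rewrite !lee_fin => rc r0.
by rewrite powR_mulrn// lerXn2r// nnegrE.
Qed.

(** Pointwise [x <= 1 + x ^+ 4]; any bound depending on [c] alone would do, so no sharper moment
    inequality is sought. *)
Lemma integral_le_of_pow4 (X : T -> R) (c : R) : 0 <= c ->
  measurable_fun setT X -> (forall z, 0 <= X z) ->
  (Lnorm P 4%:E (EFin \o X) <= c%:E)%E ->
  (\int[P]_z (X z)%:E <= (1 + c ^+ 4)%:E)%E.
Proof.
move=> c0 mX X0 Xc.
have mX4 : measurable_fun setT (fun z => (X z ^+ 4)%:E).
  by apply/measurable_EFinP; apply: measurable_funX.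
have X40 z : (0 <= (X z ^+ 4)%:E)%E by rewrite lee_fin exprn_ge0.
apply: (@le_trans _ _ (\int[P]_z (1%:E + (X z ^+ 4)%:E)))%E.
  apply: ge0_le_integral => //.
  - by move=> z _; rewrite lee_fin.
  - exact/measurable_EFinP.
  - by apply: emeasurable_funD => //; exact: measurable_cst.
  - move=> z _; rewrite -EFinD lee_fin; move: (X z) => x.
    have := sqr_ge0 (x - 1); have := sqr_ge0 (x ^+ 2 - 1).
    by rewrite -[4%N]/(2 * 2)%N exprM; nra.
rewrite ge0_integralD//.
rewrite integral_cst//= probability_setT mule1 EFinD leeD2l//.
exact: Lnorm4_le.
Qed.

(** A finite linear combination commutes with the integral, so a pointwise bound survives. This is
    what stands in for differentiation under the integral sign. *)
Lemma normr_lincomb_integral_le n (g : 'I_n -> T -> R) (a : 'I_n -> R)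
    (K : T -> R) (C : R) :
  (forall i, P.-integrable setT (EFin \o g i)) ->
  measurable_fun setT K -> (forall z, 0 <= K z) ->
  (forall z, `|\sum_i a i * g i z| <= K z) ->
  (\int[P]_z (K z)%:E <= C%:E)%E ->
  `|\sum_i a i * fine (\int[P]_z (g i z)%:E)%E| <= C.
Proof.
move=> gi mK K0 gK KC.
have ai i : P.-integrable setT (fun z => ((a i)%:E * (g i z)%:E)%E).
  by apply: integrableZl => //; exact: (gi i).
have Fi i : (\int[P]_z (g i z)%:E)%E \is a fin_num.
  by apply: integrable_fin_num => //; exact: gi.
have E : (\sum_i a i * fine (\int[P]_z (g i z)%:E)%E)%:E =
    (\int[P]_z (\sum_i a i * g i z)%:E)%E.
  transitivity (\int[P]_z (\sum_i (a i)%:E * (g i z)%:E))%E; last first.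
    by apply: eq_integral => z _; rewrite -sumEFin; apply: eq_bigr => i _.
  rewrite -sumEFin integral_sum//; apply: eq_bigr => i _.
  by rewrite integralZl ?EFinM ?fineK//; exact: gi.
rewrite -lee_fin -[(`|_|)%:E]/(`|(\sum_i _)%:E|)%E E.
have mS : measurable_fun setT (fun z => (\sum_i a i * g i z)%:E).
  apply/measurable_EFinP; apply: measurable_sum => i.
  apply: measurable_funM; first exact: measurable_cst.
  by have /integrableP[/measurable_EFinP] := gi i.
apply: le_trans (le_abse_integral P measurableT mS) _.
apply: le_trans KC; apply: ge0_le_integral => //.
- exact: measurableT_comp.
- exact/measurable_EFinP.
- by move=> z _; rewrite lee_fin gK.
Qed.

End Moments.

(** * Third differences and vanishing step sizes *)

Section ThirdDifference.
Variables (R : realType) (q : nat).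
Implicit Types (g : 'cV[R]_q -> R) (x v : 'cV[R]_q).

(* The combination of values of [g] that annihilates quadratic polynomials. *)
Definition third_difference g x v (h : R) : R :=
  g (x + v) - g x - (g (x + h *: v) - g (x - h *: v)) / (2 * h)
  - (g (x + h *: v) + g (x - h *: v) - 2 * g x) / (2 * h ^+ 2).

(** The central quotients recover the linear and quadratic terms up to the cubic errors at [h *: v]
    and [- (h *: v)], divided by [h] or [h ^+ 2]. Hence the third difference is the Taylor remainder
    at [v] up to order [h], with no bound assumed on that remainder. *)
Lemma third_difference_le g x v (a : 'cV[R]_q) (A : 'M[R]_q) (K h : R) :
  0 < h -> h <= 1 ->
  `|g (x + h *: v) - g x - dot (h *: v) a - 2^-1 * qform A (h *: v)| <=
     K * enorm (h *: v) ^+ 3 ->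
  `|g (x - h *: v) - g x - dot (- (h *: v)) a - 2^-1 * qform A (- (h *: v))|
     <= K * enorm (- (h *: v)) ^+ 3 ->
  `|third_difference g x v h -
    (g (x + v) - g x - dot v a - 2^-1 * qform A v)| <=
    2 * K * enorm v ^+ 3 * h.
Proof.
move=> h0 h1; rewrite -(scaleNr h v) !dotZl !qformZ !enormZ normrN (gtr0_norm h0) /third_difference.
rewrite (scaleNr h v); set gp := g (x + _); set gm := g (x - _); set g0 := g x.
set D := dot v a; set Q := qform A v; set e := enorm v.
rewrite sqrrN !exprMn.
set P1 := gp - _ - _ - _; set P2 := gm - _ - _ - _ => b1 b2.
have hn : h != 0 by rewrite gt_eqF.
have -> : g (x + v) - g0 - (gp - gm) / (2 * h) - (gp + gm - 2 * g0) / (2 * h ^+ 2)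
  - (g (x + v) - g0 - D - 2^-1 * Q) =
  - ((P1 - P2) * h + (P1 + P2)) / (2 * h ^+ 2).
  by rewrite /P1 /P2; field; rewrite hn.
rewrite normrM normrN [X in _ * X]gtr0_norm ?invr_gt0 ?mulr_gt0 ?exprn_gt0//.
rewrite ler_pdivrMr ?mulr_gt0 ?exprn_gt0//.
set k := K * (h ^+ 3 * e ^+ 3) in b1 b2.
have k0 : 0 <= k by exact: le_trans b1.
rewrite [leRHS](_ : _ = 4 * k); last by rewrite /k; ring.
move: b1 b2; rewrite !ler_norml => /andP[? ?] /andP[? ?]; apply/andP; split; nra.
Qed.

End ThirdDifference.

(** The limit [h -> 0] without filters: if [b < a], an explicit [h] makes the slack smaller than the
    gap. *)
Lemma ler_of_linear_slack (R : realType) (a b c : R) :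
  (forall h, 0 < h -> h <= 1 -> a <= b + c * h) -> a <= b.
Proof.
move=> abc; rewrite leNgt; apply/negP => ba.
have d0 : 0 < a - b by rewrite subr_gt0.
pose h := (a - b) / (2 * (`|c| + (a - b))).
have den0 : 0 < 2 * (`|c| + (a - b)) by rewrite mulr_gt0// ltr_wpDl.
have h0 : 0 < h by rewrite divr_gt0.
have h1 : h <= 1.
  by rewrite /h ler_pdivrMr// mul1r; have := normr_ge0 c; lra.
have := abc h h0 h1; apply/negP; rewrite -ltNge -ltrBrDl.
apply: le_lt_trans (_ : `|c| * h < _); first by rewrite ler_wpM2r ?ler_norm// ltW.
rewrite /h mulrA ltr_pdivrMr//; have := normr_ge0 c; nra.
Qed.

Lemma eq0_of_linear_slack (R : realType) (a c : R) :
  (forall h, 0 < h -> h <= 1 -> `|a| <= c * h) -> a = 0.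
Proof.
move=> ac; apply/normr0_eq0/eqP; rewrite eq_le normr_ge0 andbT.
by apply: (@ler_of_linear_slack _ _ _ c) => h h0 h1; rewrite add0r ac.
Qed.

Lemma normr_bform_sub_le (R : realType) n (A B : 'M[R]_n) (x y : 'cV[R]_n) :
  `|bform A x y - bform B x y| <= opnorm (A - B) * enorm x * enorm y.
Proof. by rewrite -bformB; exact: normr_bform_le. Qed.

Lemma normr_qform_sub_le (R : realType) n (A B : 'M[R]_n) (x : 'cV[R]_n) :
  `|qform A x - qform B x| <= opnorm (A - B) * enorm x * enorm x.
Proof. by rewrite !qformE; exact: normr_bform_sub_le. Qed.

(** Arithmetic core of the symmetry of the Hessian. [F0], [F1], [F2] are the values at x0, x0 + hu
    and x0 + hu + hv, while [U] and [V] are the two mixed terms. Reaching [F2] in one step gives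
    half of [U + V] at order [h ^+ 2], reaching it through [F1] gives [V]; so [U - V] is of order
    [h]. *)
Lemma second_difference_sym (R : realType)
    (h l a b F2 F1 F0 X Y Q Q' U V : R) :
  0 < h -> 0 <= l -> 0 <= a -> 0 <= b ->
  `|F2 - F1 - h * (X * h) - 2^-1 * (h ^+ 2 * Y)| <= l * (h ^+ 3 * b ^+ 3) ->
  `|F1 - F0 - 2^-1 * (h ^+ 2 * Q)| <= l * (h ^+ 3 * a ^+ 3) ->
  `|F2 - F0 - 2^-1 * (h ^+ 2 * (Q + Q' + U + V))| <= l * (h ^+ 3 * (a + b) ^+ 3) ->
  `|X - V| <= l * (h * a) * b * a ->
  `|Y - Q'| <= l * (h * a) * b * b ->
  `|U - V| <= 2 * (l * (a + b) ^+ 3 + l * a ^+ 3 + l * b ^+ 3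
   + l * (a ^+ 2 * b) + l * (a * b ^+ 2)) * h.
Proof.
move=> h0 l0 a0 b0; set K := 2 * _.
rewrite !ler_norml => /andP[p1 p2] /andP[p3 p4] /andP[p5 p6] /andP[p7 p8] /andP[p9 p10].
have h20 : 0 < h ^+ 2 by rewrite exprn_gt0.
have Kh : h ^+ 2 * (K * h) = 2 * (l * (h ^+ 3 * (a + b) ^+ 3) + l * (h ^+ 3 * a ^+ 3)
   + l * (h ^+ 3 * b ^+ 3) + h ^+ 2 * (l * (h * a) * b * a) + h ^+ 2 * (l * (h * a) * b * b)).
  by rewrite /K; ring.
have q7 := ler_wpM2l (ltW h20) p7; have q8 := ler_wpM2l (ltW h20) p8.
have q9 := ler_wpM2l (ltW h20) p9; have q10 := ler_wpM2l (ltW h20) p10.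
have hX : h * (X * h) = h ^+ 2 * X by ring.
rewrite hX in p1 p2.
have nn : 0 <= l * (h ^+ 3 * a ^+ 3) by rewrite !mulr_ge0 ?exprn_ge0// ltW.
have n2 : 0 <= h ^+ 2 * (l * (h * a) * b * b) by rewrite !mulr_ge0 ?exprn_ge0// ltW.
apply/andP; split; rewrite -(ler_pM2l h20) ?mulrN Kh; lra.
Qed.

(** * Local expansion at the minimizer *)

Section LocalExpansion.
Variables (R : realType) (q : nat) (f : 'cV[R]_q -> R) (x0 : 'cV[R]_q).
Variables (r L C mu : R).
Hypothesis r_gt0 : 0 < r.
Hypothesis f_diff : forall t, enorm (t - x0) < r ->
  differentiable f t /\ differentiable (grad f) t.
Hypothesis f_lip : forall t1 t2, enorm (t1 - x0) < r -> enorm (t2 - x0) < r ->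
  opnorm (hess f t1 - hess f t2) <= L * enorm (t1 - t2).
Hypothesis f_growth : forall v, enorm v < r ->
  mu * enorm v ^+ 2 <= f (x0 + v) - f x0.
Hypothesis f_third : forall v h, enorm v < r -> 0 < h -> h <= 1 ->
  `|third_difference f x0 v h| <= C * enorm v ^+ 3.
Hypothesis mu_gt0 : 0 < mu.

Let H := hess f x0.
Let g := (grad f x0)^T.

Lemma enorm_line_lt (v : 'cV[R]_q) (s : R) : enorm v < r -> `|s| <= 1 ->
  enorm (s *: v) < r.
Proof.
move=> vr s1; rewrite enormZ; apply: le_lt_trans vr.
by rewrite ler_piMl ?enorm_ge0.
Qed.

Lemma taylor2_ball (u v : 'cV[R]_q) : enorm u + enorm v < r ->
  `|f (x0 + u + v) - f (x0 + u) - dot v (grad f (x0 + u))^T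
    - 2^-1 * qform (hess f (x0 + u)) v| <= L * enorm v ^+ 3.
Proof.
move=> uvr.
have ball s : 0 <= s <= 1 -> enorm (x0 + u + s *: v - x0) < r.
  move=> /andP[s0 s1].
  have -> : x0 + u + s *: v - x0 = u + s *: v by rewrite addrAC (addrC x0) addrK.
  apply: le_lt_trans uvr; apply: le_trans (enormD_le _ _) _.
  by rewrite lerD2l enormZ ger0_norm// ler_piMl ?enorm_ge0.
apply: taylor2 => s s01; first exact/f_diff/ball.
apply: le_trans (f_lip (ball s s01) _) _.
  rewrite addrC addKr; apply: le_lt_trans uvr.
  by rewrite lerDl enorm_ge0.
by rewrite (addrC (x0 + u)) addrK enormZ ger0_norm//; case/andP: s01.
Qed.

Lemma taylor2_center (v : 'cV[R]_q) : enorm v < r ->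
  `|f (x0 + v) - f x0 - dot v g - 2^-1 * qform H v| <= L * enorm v ^+ 3.
Proof.
by move=> vr; have := @taylor2_ball 0 v; rewrite enorm0 add0r addr0; apply.
Qed.

(** Growth makes the increment along [h *: w] nonnegative; dividing by [h] and letting it vanish
    gives [0 <= dot w g], used for [v] and [- v]. *)
Lemma dot_grad_eq0 (v : 'cV[R]_q) : enorm v < r -> dot v g = 0.
Proof.
move=> vr; suff le0 w : enorm w < r -> 0 <= dot w g.
  apply/eqP; rewrite eq_le le0// andbT -oppr_ge0.
  have := le0 (- v); rewrite -scaleN1r dotZl mulN1r; apply.
  by apply: enorm_line_lt => //; rewrite normrN1.
move=> wr.
apply: (@ler_of_linear_slack _ _ _ (2^-1 * `|qform H w| + `|L| * enorm w ^+ 3)) => h h0 h1.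
have hr : enorm (h *: w) < r by apply: enorm_line_lt => //; rewrite gtr0_norm.
have := le_trans (ler_norm _) (taylor2_center hr).
have := f_growth hr; rewrite dotZl qformZ enormZ (gtr0_norm h0).
have e0 := enorm_ge0 w.
have : 0 <= mu * (h * enorm w) ^+ 2 by rewrite mulr_ge0 ?sqr_ge0// ltW.
move=> m0 gr ta.
have key : 0 <= h * (dot w g + (2^-1 * `|qform H w| + `|L| * enorm w ^+ 3) * h).
  have : 0 <= h * dot w g + 2^-1 * (h ^+ 2 * qform H w) + L * (h * enorm w) ^+ 3.
    by move: m0 gr ta; set a := f _; set b := f _; set m := mu * _; lra.
  move/le_trans; apply.
  have -> : h * (dot w g + (2^-1 * `|qform H w| + `|L| * enorm w ^+ 3) * h) =
    h * dot w g + 2^-1 * (h ^+ 2 * `|qform H w|) + `|L| * (h ^+ 2 * enorm w ^+ 3) by ring.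
  rewrite -!addrA lerD2l lerD//.
    by rewrite ler_wpM2l// ler_wpM2l ?sqr_ge0// ler_norm.
  apply: le_trans (_ : `|L| * (h * enorm w) ^+ 3 <= _).
    by rewrite ler_wpM2r ?ler_norm// exprn_ge0// mulr_ge0// ltW.
  rewrite ler_wpM2l// exprMn ler_wpM2r ?exprn_ge0//.
  by rewrite exprS ler_piMl// sqr_ge0.
by rewrite -(pmulr_rge0 _ h0).
Qed.

(** The Taylor expansion with constant [L] only identifies the limit of the third difference. [L]
    multiplies [h] and disappears with it, leaving the constant [C]. *)
Lemma quadratic_expansion (v : 'cV[R]_q) : enorm v < r ->
  `|f (x0 + v) - f x0 - 2^-1 * qform H v| <= C * enorm v ^+ 3.
Proof.
move=> vr.
apply: (@ler_of_linear_slack _ _ _ (2 * L * enorm v ^+ 3)) => h h0 h1.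
have hr : enorm (h *: v) < r by apply: enorm_line_lt => //; rewrite gtr0_norm.
have hr' : enorm (- (h *: v)) < r.
  by rewrite -scaleNr; apply: enorm_line_lt => //; rewrite normrN gtr0_norm.
have := third_difference_le (g := f) (x := x0) (v := v) (a := g) h0 h1
  (taylor2_center hr) (taylor2_center hr').
have := f_third vr h0 h1; rewrite dot_grad_eq0// subr0.
set a := third_difference _ _ _ _; set b := f _ - _ - _ => ha hab.
have := ler_normD (b - a) a; rewrite subrK (distrC b a); lra.
Qed.

(** Growth and expansion are compared at [h *: w] and divided by [h ^+ 2]; homogeneity removes the
    restriction to small vectors. *)
Lemma qform_hess_ge (v : 'cV[R]_q) : 2 * mu * enorm v ^+ 2 <= qform H v.
Proof.
suff small w : enorm w < r -> 2 * mu * enorm w ^+ 2 <= qform H w.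
  pose s := r / (2 * (enorm v + 1)).
  have e0 := enorm_ge0 v.
  have s0 : 0 < s by rewrite divr_gt0// mulr_gt0// ltr_wpDl.
  have := small (s *: v); rewrite qformZ enormZ gtr0_norm// exprMn mulrCA.
  rewrite ler_pM2l ?exprn_gt0//; apply.
  rewrite /s mulrAC ltr_pdivrMr ?mulr_gt0 ?ltr_wpDl//.
  by have := mulr_ge0 (ltW r_gt0) e0; have := r_gt0; nra.
move=> wr; apply: (@ler_of_linear_slack _ _ _ (2 * C * enorm w ^+ 3)) => h h0 h1.
have hr : enorm (h *: w) < r by apply: enorm_line_lt => //; rewrite gtr0_norm.
have := le_trans (ler_norm _) (quadratic_expansion hr).
have := f_growth hr; rewrite qformZ enormZ (gtr0_norm h0) => gr ta.
have h20 : 0 < h ^+ 2 by rewrite exprn_gt0.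
rewrite -(ler_pM2l h20).
have : mu * (h * enorm w) ^+ 2 <= 2^-1 * (h ^+ 2 * qform H w) + C * (h * enorm w) ^+ 3.
  by move: gr ta; set a := f _; set b := f _; lra.
rewrite !exprMn => k; nra.
Qed.

(** The value at x0 + hu + hv is expanded once from x0 and once from x0 + hu; the two second-order
    terms differ by the antisymmetric part. *)
Lemma bform_hess_sym (u v : 'cV[R]_q) : enorm u + enorm v < r ->
  bform H u v = bform H v u.
Proof.
move=> uvr; apply/eqP; rewrite -subr_eq0; apply/eqP.
have u0 := enorm_ge0 u; have v0 := enorm_ge0 v.
set a := enorm u in uvr u0 *; set b := enorm v in uvr v0 *.
pose K := 2 * (`|L| * (a + b) ^+ 3 + `|L| * a ^+ 3 + `|L| * b ^+ 3
   + `|L| * (a ^+ 2 * b) + `|L| * (a * b ^+ 2)).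
apply: (@eq0_of_linear_slack _ _ K) => h h0 h1.
have ur : a < r by apply: le_lt_trans uvr; rewrite lerDl.
have hn : `|h| = h by rewrite gtr0_norm.
have hur : enorm (h *: u) < r by apply: enorm_line_lt => //; rewrite hn.
have huvr : enorm (h *: u) + enorm (h *: v) < r.
  by rewrite !enormZ hn -mulrDr; apply: le_lt_trans uvr; rewrite ler_piMl// addr_ge0.
have huvr' : enorm (h *: (u + v)) < r.
  by rewrite scalerDr; apply: le_lt_trans huvr; exact: enormD_le.
have T1 := taylor2_ball huvr.
have T3 := taylor2_center huvr'.
have T3' := taylor2_center hur.
rewrite dot_grad_eq0// subr0 in T3; rewrite dot_grad_eq0// subr0 in T3'.
(* As the gradient vanishes at [x0], the mean value theorem writes its [v]-component at
   [x0 + h *: u] as [h] times a mixed second derivative at an intermediate point. *)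
have [s /andP[s0 sh]|s /andP[s0 sh]] := @MVT01 _ (fun s => dot v (grad f (x0 + s *: u))^T)
  (fun s => bform (hess f (x0 + s *: u)) v u) h h0.
  apply: is_derive_grad_line; apply: (f_diff _).2.
  rewrite addrC addKr; apply: enorm_line_lt => //.
  by rewrite ger0_norm// (le_trans sh).
rewrite scale0r addr0 -/g dot_grad_eq0; last first.
  by apply: le_lt_trans uvr; rewrite lerDr.
rewrite subr0 => T2.
have su : enorm (s *: u) < r.
  by apply: enorm_line_lt => //; rewrite gtr0_norm// (le_trans (ltW sh)).
have lipu t : 0 < t -> t <= h -> opnorm (hess f (x0 + t *: u) - H) <= `|L| * (h * a).
  move=> t0 th; apply: le_trans (f_lip _ _) _.
  - rewrite addrC addKr; apply: enorm_line_lt => //.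
    by rewrite gtr0_norm// (le_trans th).
  - by rewrite subrr enorm0.
  rewrite addrC addKr enormZ gtr0_norm//.
  apply: le_trans (_ : `|L| * (t * a) <= _).
    by rewrite ler_wpM2r ?ler_norm// mulr_ge0// ltW.
  by rewrite ler_wpM2l// ler_wpM2r.
have B1 : `|bform (hess f (x0 + s *: u)) v u - bform H v u| <= `|L| * (h * a) * b * a.
  apply: le_trans (normr_bform_sub_le _ _ _ _) _.
  by rewrite -/a -/b !ler_wpM2r// lipu// ltW.
have B2 : `|qform (hess f (x0 + h *: u)) v - qform H v| <= `|L| * (h * a) * b * b.
  apply: le_trans (normr_qform_sub_le _ _ _) _.
  by rewrite -/b !ler_wpM2r// lipu.
have Lp t : 0 <= t -> L * t <= `|L| * t by move=> ?; rewrite ler_wpM2r// ler_norm.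
have T1' := le_trans T1 (Lp _ (exprn_ge0 3 (enorm_ge0 _))).
have T3a := le_trans T3 (Lp _ (exprn_ge0 3 (enorm_ge0 _))).
have T3b := le_trans T3' (Lp _ (exprn_ge0 3 (enorm_ge0 _))).
have T3c : `|f (x0 + h *: (u + v)) - f x0 - 2^-1 * qform H (h *: (u + v))| <= `|L| * (h ^+ 3 * (a + b) ^+ 3).
  apply: le_trans T3a _; rewrite ler_wpM2l// enormZ hn exprMn.
  apply: ler_wpM2l; first by rewrite exprn_ge0// ltW.
  by rewrite lerXn2r ?nnegrE ?enorm_ge0 ?addr_ge0// enormD_le.
rewrite dotZl T2 qformZ enormZ hn exprMn -/b in T1'.
rewrite qformZ enormZ hn exprMn -/a in T3b.
rewrite qformZ qformD in T3c.
rewrite scalerDr addrA in T3c.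
exact: (second_difference_sym h0 (normr_ge0 L) (enorm_ge0 u) (enorm_ge0 v) T1' T3b T3c B1 B2).
Qed.

Lemma hess_sym : H^T = H.
Proof.
apply/matrixP => i j; rewrite mxE.
pose s := r / 3.
have s0 : 0 < s by rewrite divr_gt0.
pose e k : 'cV[R]_q := s *: delta_mx k 0.
have d1 (k : 'I_q) : enorm (delta_mx k 0 : 'cV[R]_q) = 1.
  rewrite /enorm (bigD1 k)//= mxE !eqxx expr1n big1 ?addr0 ?sqrtr1//.
  by move=> l /negbTE lk; rewrite mxE lk expr0n.
have dH k l : bform H (e k) (e l) = s ^+ 2 * H k l.
  rewrite /bform /e -scalemxAr dotZl dotZr mulrA expr2; congr (_ * _).
  rewrite /dot (bigD1 k)//= mxE !eqxx mul1r big1 ?addr0; last first.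
    by move=> o /negbTE ok; rewrite mxE ok mul0r.
  by rewrite -colE mxE.
have uv : enorm (e j) + enorm (e i) < r.
  by rewrite /e !enormZ !d1 !mulr1 gtr0_norm// /s; have := r_gt0; lra.
have := bform_hess_sym uv; rewrite !dH; apply: mulfI.
by rewrite gt_eqF// exprn_gt0.
Qed.

End LocalExpansion.

(** * Covariance of the gradient *)

Section Covariance.
Variables (R : realType) (d : measure_display) (T : measurableType d)
  (P : probability T R).

Lemma variance_le_second_moment (X : T -> R) : measurable_fun setT X ->
  (\int[P]_z (X z ^+ 2)%:E < +oo)%E ->
  ((fine (covariance P X X))%:E <= \int[P]_z (X z ^+ 2)%:E)%E.
Proof.
move=> mX X2.
have LX : X \in Lfun P 2%:E.
  rewrite inE; apply/andP; split; first by rewrite inE.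
  rewrite inE /finite_norm/= unlock /Lnorm poweR_lty//.
  rewrite (eq_integral (fun z => (X z ^+ 2)%:E))// => z _ /=.
  by rewrite powR_mulrn ?normr_ge0// real_normK// num_real.
have E2 : ('E_P[X ^+ 2] = \int[P]_z (X z ^+ 2)%:E)%E by rewrite unlock.
have L1 : X \in Lfun P 1 by rewrite Lfun_subset12 ?fin_num_measure.
have E1 := expectation_fin_num L1.
rewrite -E2 -[covariance P X X]/('V_P[X]) varianceE//.
have : 'E_P[X ^+ 2]%E \is a fin_num.
  by rewrite E2; apply: integrable_fin_num => //; exact: Lfun2_integrable_sqr.
move=> E2f; rewrite fineK; last by rewrite fin_numB E2f fin_numX.
by rewrite leeBlDr ?fin_numX// leeDl// expe2 sqre_ge0.
Qed.

(** The trace is at most the second moment of the norm, which the fourth moment controls through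
    [x ^+ 2 <= k + l * x ^+ 4]. The weights below satisfy [k + l * c ^+ 4 = c ^+ 2], so nothing is
    lost. *)
Lemma cov_mx_trace_le q (g : T -> 'rV[R]_q) (c : R) :
  0 < c -> (forall i, measurable_fun setT (fun z => g z 0 i)) ->
  (Lnorm P 4%:E (fun z => (enorm (g z)^T)%:E) <= c%:E)%E ->
  \sum_i cov_mx P g i i <= c ^+ 2.
Proof.
move=> c0 mg gc.
have I4 := Lnorm4_le (ltW c0) gc.
have m2 i : measurable_fun setT (fun z => (g z 0 i ^+ 2)%:E).
  by apply/measurable_EFinP; apply: measurable_funX.
have gE z : enorm (g z)^T ^+ 2 = \sum_i g z 0 i ^+ 2.
  by rewrite sqr_enorm; apply: eq_bigr => i _; rewrite mxE.
have mg2 : measurable_fun setT (fun z => enorm (g z)^T ^+ 2).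
  rewrite (_ : (fun _ => _) = fun z => \sum_i g z 0 i ^+ 2); last exact/funext.
  by apply: measurable_sum => i; apply: measurable_funX.
have g4 z : enorm (g z)^T ^+ 4 = (enorm (g z)^T ^+ 2) ^+ 2 by rewrite -exprM.
have mg4 : measurable_fun setT (fun z => (enorm (g z)^T ^+ 4)%:E).
  apply/measurable_EFinP; rewrite (_ : (fun _ => _) = (fun z => (enorm (g z)^T ^+ 2) ^+ 2)).
    exact: measurable_funX.
  exact/funext.
have c20 : 0 < c ^+ 2 by rewrite exprn_gt0.
pose k := c ^+ 2 / 2; pose l := (2 * c ^+ 2)^-1.
have k0 : 0 <= k by rewrite divr_ge0// ltW.
have l0 : 0 <= l by rewrite invr_ge0 mulr_ge0// ltW.
have I2 : (\int[P]_z (enorm (g z)^T ^+ 2)%:E <= (c ^+ 2)%:E)%E.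
  apply: (@le_trans _ _ (\int[P]_z (k%:E + l%:E * (enorm (g z)^T ^+ 4)%:E)))%E.
    apply: ge0_le_integral => //.
    - by move=> z _; rewrite lee_fin sqr_ge0.
    - exact/measurable_EFinP.
    - by apply: emeasurable_funD => //; apply: emeasurable_funM.
    - move=> z _; rewrite -EFinM -EFinD lee_fin g4 -subr_ge0.
      have -> : k + l * (enorm (g z)^T ^+ 2) ^+ 2 - enorm (g z)^T ^+ 2 =
          l * (enorm (g z)^T ^+ 2 - c ^+ 2) ^+ 2.
        by rewrite /k /l; field; rewrite gt_eqF.
      by rewrite mulr_ge0 ?sqr_ge0.
  rewrite ge0_integralD//; last 2 first.
  - by move=> z _; rewrite mule_ge0// lee_fin ?exprn_ge0 ?enorm_ge0.
  - by apply: emeasurable_funM.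
  rewrite integral_cst//= probability_setT mule1 ge0_integralZl//; last first.
    by move=> z _; rewrite lee_fin exprn_ge0// enorm_ge0.
  apply: le_trans (leeD (lexx _) (lee_wpmul2l _ I4)) _; first by rewrite lee_fin.
  rewrite -EFinM -EFinD lee_fin le_eqVlt; apply/orP; left; apply/eqP.
  by rewrite /k /l; field; rewrite gt_eqF.
have IE : (\int[P]_z (enorm (g z)^T ^+ 2)%:E = \sum_i \int[P]_z (g z 0 i ^+ 2)%:E)%E.
  under eq_integral do rewrite gE -sumEFin.
  by rewrite ge0_integral_sum// => i z _; rewrite lee_fin sqr_ge0.
have fin i : (\int[P]_z (g z 0 i ^+ 2)%:E < +oo)%E.
  apply: le_lt_trans (ltry (c ^+ 2)); apply: le_trans I2.
  apply: ge0_le_integral => //.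
  - by move=> z _; rewrite lee_fin sqr_ge0.
  - exact/measurable_EFinP.
  - move=> z _; rewrite lee_fin gE (bigD1 i)//= lerDl sumr_ge0// => j _.
    exact: sqr_ge0.
rewrite -lee_fin -sumEFin; apply: le_trans I2; rewrite IE.
apply: lee_sum => i _; rewrite mxE; exact: variance_le_second_moment.
Qed.

(** A partial derivative is the limit of difference quotients along steps tending to 0 that stay
    inside the ball of radius [r]. *)
Lemma measurable_grad_coord q (m : 'cV[R]_q -> T -> R) (x : 'cV[R]_q) (r : R)
    (i : 'I_q) : 0 < r ->
  (forall t, enorm (t - x) < r -> measurable_fun setT (m t)) ->
  (forall z, differentiable (m ^~ z) x) ->
  measurable_fun setT (fun z => grad (m ^~ z) x 0 i).
Proof.
move=> r0 mm dm.
pose s n : R := r / 2 / n.+1%:R.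
have s0 n : 0 < s n by rewrite !divr_gt0.
have d1 : enorm (delta_mx i 0 : 'cV[R]_q) = 1.
  rewrite /enorm (bigD1 i)//= mxE !eqxx expr1n big1 ?addr0 ?sqrtr1//.
  by move=> l /negbTE lk; rewrite mxE lk expr0n.
apply: (@measurable_fun_cvg _ _ _ setT (fun n z =>
    (s n)^-1 *: (m (s n *: delta_mx i 0 + x) z - m x z))).
  move=> n; apply: measurable_funM; first exact: measurable_cst.
  apply: measurable_funB; apply: mm.
    rewrite addrK enormZ d1 mulr1 gtr0_norm//.
    apply: le_lt_trans (_ : r / 2 < r); last by rewrite ltr_pdivrMr//; lra.
    by rewrite /s ler_pdivrMr// ler_peMr ?ler1n// divr_ge0// ltW.
  by rewrite subrr enorm0.
move=> z _; rewrite mxE.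
have /cvgr_dnbhsP := @diff_derivable _ _ _ (m ^~ z) x (delta_mx i 0) (dm z).
rewrite -/(derive (m ^~ z) x (delta_mx i 0)) => h.
apply: h; split=> [n|]; first by rewrite gt_eqF.
rewrite -(mulr0 (r / 2)); apply: cvgMr.
exact: cvg_harmonic.
Qed.

End Covariance.

(** * Bound on the limiting quadratic form *)

Section SandwichBound.
Variables (R : realType) (q : nat).

(** Coercivity leaves no kernel. This guarantees that [invmx H] is a genuine inverse and not a
    default value. *)
Lemma qform_unitmx (H : 'M[R]_q) (mu : R) : 0 < mu ->
  (forall v, mu * enorm v ^+ 2 <= qform H v) -> H \in unitmx.
Proof.
move=> mu0 Hmu; rewrite -unitmx_tr -row_free_unit -kermx_eq0.
apply/rowV0P => v /sub_kermxP vH.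
have Hv : H *m v^T = 0 by apply: trmx_inj; rewrite trmx_mul trmxK vH trmx0.
have := Hmu v^T; rewrite qformE /bform Hv -(scale0r 0) dotZr mul0r => h.
have : enorm v^T ^+ 2 <= 0 by rewrite -(pmulr_rle0 _ mu0).
move=> h2; have : enorm v^T = 0.
  by apply/eqP; rewrite -sqrf_eq0 eq_le h2 sqr_ge0.
by move/enorm_eq0 => /(congr1 trmx); rewrite trmxK trmx0.
Qed.

(** For [N = H *m M] one has [N *m N^T = S], so the squared norm of [N *m y] is at most the trace of
    [S] times that of [y]. With [x = M *m y], coercivity and Cauchy-Schwarz give
    [2 * mu * enorm x <= enorm (N *m y)], which bounds the form without any eigenvalue of [M]. *)
Lemma half_qform_sandwich_le (H M S : 'M[R]_q) (mu s : R) (y : 'cV[R]_q) :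
  0 < mu -> (forall v, 2 * mu * enorm v ^+ 2 <= qform H v) -> H^T = H ->
  is_psd_sqrt M (invmx H *m S *m invmx H) -> \sum_i S i i <= s ->
  2^-1 * qform (M *m H *m M) y <= s / (4 * mu) * \sum_i y i 0 ^+ 2.
Proof.
move=> mu0 Hmu HT [[MT _] MM] Ss.
have Hu : H \in unitmx by apply: (qform_unitmx (mulr_gt0 (ltr0n R 2) mu0)).
pose N := H *m M.
have NN : N *m N^T = S.
  rewrite /N trmx_mul MT HT mulmxA -(mulmxA H M M) MM.
  by rewrite !mulmxA mulmxV// mul1mx -mulmxA mulVmx// mulmx1.
have Ny : enorm (N *m y) ^+ 2 <= s * enorm y ^+ 2.
  apply: le_trans (_ : (\sum_i S i i) * enorm y ^+ 2 <= _); last first.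
    by rewrite ler_wpM2r// sqr_ge0.
  rewrite sqr_enorm mulr_suml; apply: ler_sum => i _.
  rewrite -NN !mxE; apply: le_trans (sum_cauchy_schwarz (N i) (y ^~ 0)) _.
  rewrite sqr_enorm ler_wpM2r ?sumr_ge0// => [k _|]; first exact: sqr_ge0.
  by apply: ler_sum => k _; rewrite [N^T k i]mxE expr2.
rewrite -sqr_enorm.
have -> : qform (M *m H *m M) y = qform H (M *m y).
  by rewrite /qform trmx_mul MT !mulmxA.
set x := M *m y; have HxE : H *m x = N *m y by rewrite /N mulmxA.
have := Hmu x; rewrite qformE => h1.
have h2 := le_trans (ler_norm _) (normr_dot_le x (H *m x)).
rewrite -/(bform H x x) HxE in h2.
set a := enorm x in h1 h2; set b := enorm (N *m y) in h2 Ny.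
have a0 : 0 <= a by exact: enorm_ge0.
have b0 : 0 <= b by exact: enorm_ge0.
have ab : 2 * mu * a <= b.
  have [->|an] := eqVneq a 0; first by rewrite mulr0.
  have ap : 0 < a by rewrite lt_neqAle eq_sym an.
  rewrite -(ler_pM2r ap) (mulrC b).
  have -> : 2 * mu * a * a = 2 * mu * a ^+ 2 by ring.
  exact: le_trans h1 h2.
rewrite mulrAC ler_pdivlMr ?mulr_gt0//.
apply: le_trans Ny.
have := ler_wpM2l b0 ab; nra.
Qed.

End SandwichBound.

(** * Comparison at a fixed sample size *)

Lemma convex_set_lmod (R : realType) (M : lmodType R)
    (A : set (convex_lmodType M)) :
  (forall (x y : M) (s : R), 0 <= s -> s <= 1 -> A x -> A y ->
     A (s *: x + (1 - s) *: y)) -> convex_set A.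
Proof.
move=> cA x y l; rewrite !inE => Ax Ay.
exact: (cA x y l%:num).
Qed.

Section QuadraticSets.
Variables (R : realType) (q : nat) (H : 'M[R]_q).

Lemma measurable_borel_qform : measurable_fun setT (qform H : borel R q -> R).
Proof.
rewrite (_ : qform H = fun y : borel R q => \sum_i \sum_j y i 0 * H i j * y j 0).
  apply: measurable_sum => i; apply: measurable_sum => j.
  apply: measurable_funM; last exact: measurable_borel_coord.
  apply: measurable_funM; last exact: measurable_cst.
  exact: measurable_borel_coord.
by apply/funext => y; rewrite qformE bformE.
Qed.

(** The convexity defect of the form between [x] and [y] is [s * (1 - s)] times its value at
    [x - y]. *)
Lemma convex_qform_lt (t : R) : (forall v, 0 <= qform H v) ->
  convex_set ([set x | qform H x < t] : set (convex_lmodType 'cV[R]_q)).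
Proof.
move=> H0; apply: convex_set_lmod => x y s s0 s1 /= xt yt.
set Qx := qform H x in xt; set Qy := qform H y in yt.
apply: (@le_lt_trans _ _ (s * Qx + (1 - s) * Qy)).
  rewrite qformD !qformZ -/Qx -/Qy /bform -!scalemxAr !dotZl !dotZr.
  rewrite -!/(bform H _ _).
  have := H0 (x - y); rewrite qformD -scaleN1r qformZ -/Qx -/Qy.
  rewrite /bform -!scalemxAr !dotZl !dotZr -!/(bform H _ _).
  set a := bform H x y; set b := bform H y x => h.
  have : 0 <= s * (1 - s) * (Qx + (-1) ^+ 2 * Qy + -1 * a + -1 * b).
    by rewrite mulr_ge0// mulr_ge0// subr_ge0.
  nra.
have [->|sn] := eqVneq s 0; first by rewrite mul0r add0r subr0 mul1r.
have sp : 0 < s by rewrite lt_neqAle eq_sym sn.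
nra.
Qed.

End QuadraticSets.

Section Comparison.
Variables (R : realType) (q : nat) (d d' : measure_display).
Variables (T : measurableType d) (T' : measurableType d').
Variables (Pr : probability T R) (Pr' : probability T' R).
Variables (Y : T' -> 'cV[R]_q) (M H : 'M[R]_q).
Variables (f : 'cV[R]_q -> R) (x0 : 'cV[R]_q) (Theta : set 'cV[R]_q).
Variables (X : T -> 'cV[R]_q) (n : nat) (e r mu b C : R).
Hypothesis q_gt0 : (0 < q)%N.
Hypothesis n_gt0 : (0 < n)%N.
Hypothesis r_gt0 : 0 < r.
Hypothesis mu_gt0 : 0 < mu.
Hypothesis b_gt0 : 0 < b.
Hypothesis C_gt0 : 0 < C.
Hypothesis gY : std_gaussian Pr' Y.
Hypothesis MT : M^T = M.
Hypothesis XTheta : forall om, Theta (X om).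
Hypothesis mX : measurable_fun setT (X : T -> borel R q).
Hypothesis mfX : measurable_fun setT (fun om => f (X om)).
Hypothesis f_exp : forall v, enorm v < r ->
  `|f (x0 + v) - f x0 - 2^-1 * qform H v| <= C * enorm v ^+ 3.
Hypothesis f_growth : forall t, Theta t ->
  mu * enorm (t - x0) ^+ 2 <= f t - f x0.
Hypothesis H_ge : forall v, 2 * mu * enorm v ^+ 2 <= qform H v.
Hypothesis G_le : forall y,
  2^-1 * qform (M *m H *m M) y <= b * q%:R * \sum_i y i 0 ^+ 2.
Hypothesis BE : forall A : set 'cV[R]_q, measurable (A : set (borel R q)) ->
  convex_set (A : set (convex_lmodType 'cV[R]_q)) ->
  `|fine (Pr [set om | A (Num.sqrt n%:R *: (X om - x0))])
      - fine (Pr' [set om | A (M *m Y om)])| <= e.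

Let F om := n%:R * f (X om) - n%:R * f x0.
Let G om := 2^-1 * qform (M *m H *m M) (Y om).
Let Q (x : 'cV[R]_q) := 2^-1 * qform H x.
Let Z om := Num.sqrt n%:R *: (X om - x0).
Let pF t := fine (Pr [set om | t <= F om]).
Let pG t := fine (Pr' [set om | t <= G om]).

Let n0 : 0 < n%:R :> R. Proof. by rewrite ltr0n. Qed.
Let sn0 : 0 < Num.sqrt n%:R :> R. Proof. by rewrite sqrtr_gt0. Qed.

Lemma qform_H_ge0 v : 0 <= qform H v.
Proof.
apply: le_trans (H_ge v); apply: mulr_ge0; last exact: sqr_ge0.
by rewrite mulr_ge0// ltW.
Qed.

Lemma G_eq_Q om : G om = Q (M *m Y om).
Proof. by rewrite /G /Q /qform trmx_mul MT !mulmxA. Qed.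

Lemma measurable_F : measurable_fun setT F.
Proof.
apply: measurable_funB; last exact: measurable_cst.
by apply: measurable_funM => //; exact: measurable_cst.
Qed.

Lemma measurable_G : measurable_fun setT
  (fun y : borel R q => 2^-1 * qform (M *m H *m M) y).
Proof.
apply: measurable_funM; first exact: measurable_cst.
exact: measurable_borel_qform.
Qed.

Lemma measurable_GY : measurable_fun setT G.
Proof. by apply: measurableT_comp measurable_G _; exact: gY.1. Qed.

Lemma measurable_Z : measurable_fun setT (Z : T -> borel R q).
Proof.
apply/measurable_borelP => i; have /measurable_borelP/(_ i) mXi := mX.
rewrite (_ : (fun _ => _) = fun om => Num.sqrt n%:R * (X om i 0 - x0 i 0)).
  apply: measurable_funM; first exact: measurable_cst.
  by apply: measurable_funB => //; exact: measurable_cst.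
by apply/funext => om; rewrite /Z !mxE.
Qed.

Lemma prob_ge_lt d1 (T1 : measurableType d1) (P1 : probability T1 R)
    (g : T1 -> R) (t : R) : measurable_fun setT g ->
  fine (P1 [set x | t <= g x]) = 1 - fine (P1 [set x | g x < t]).
Proof.
move=> mg; have -> : [set x | t <= g x] = ~` [set x | g x < t].
  by apply/seteqP; split => x /=; rewrite leNgt => /negP.
have mlt : measurable [set x | g x < t].
  rewrite [X in measurable X](_ : _ = ~` [set x | t <= g x]).
    exact/measurableC/measurable_ge.
  by apply/seteqP; split => x /=; rewrite ltNge => /negP.
by rewrite probability_setC// fineB ?fin_num_measure.
Qed.

(** Superlevel sets of [Q] are not convex, so the bound is applied to the complementary
    ellipsoid. *)
Lemma berry_esseen_Q t : `|fine (Pr [set om | t <= Q (Z om)]) - pG t| <= e.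
Proof.
have mQ : measurable_fun setT (Q : borel R q -> R).
  apply: measurable_funM; first exact: measurable_cst.
  exact: measurable_borel_qform.
have A_Q : [set x | Q x < t] = [set x | qform H x < 2 * t].
  by apply/seteqP; split => x /=; rewrite /Q; lra.
have mA : measurable ([set x | Q x < t] : set (borel R q)).
  rewrite [X in measurable X](_ : _ = ~` [set x | t <= Q x]).
    exact/measurableC/measurable_ge.
  by apply/seteqP; split => x /=; rewrite ltNge => /negP.
have cA : convex_set ([set x | Q x < t] : set (convex_lmodType 'cV[R]_q)).
  by rewrite A_Q; apply: convex_qform_lt; exact: qform_H_ge0.
have h := BE mA cA; rewrite /pG !prob_ge_lt; last 2 first.
- exact: measurable_GY.
- by apply: (measurableT_comp mQ); exact: measurable_Z.
have EG : G = fun om => Q (M *m Y om) by apply/funext => om; exact: G_eq_Q.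
rewrite EG; set a := fine _; set b' := fine _.
have -> : 1 - a - (1 - b') = - (a - b') by ring.
by rewrite normrN; exact: h.
Qed.

(** Within this radius the expansion holds and its cubic error is at most half of the growth
    [mu * enorm v ^+ 2]. *)
Let rho0 := Num.min r (mu / (2 * C)).

Let rho0_gt0 : 0 < rho0.
Proof. by rewrite lt_min r_gt0 divr_gt0// mulr_gt0. Qed.

(** The highest level for which [F < t] forces the estimator into the ball of radius [rho0]. *)
Let t0 := n%:R * mu * rho0 ^+ 2.

Let t0_gt0 : 0 < t0.
Proof. by rewrite mulr_gt0 ?exprn_gt0// mulr_gt0. Qed.

(** The cubic error at distance [Num.sqrt (t / (n%:R * mu))], multiplied by [n] and taken relative
    to [t]. *)
Let delta t := C / mu * Num.sqrt (t / (n%:R * mu)).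

Lemma sqrt_le_rho0 t : 0 < t -> t <= t0 -> Num.sqrt (t / (n%:R * mu)) <= rho0.
Proof.
move=> tp tt0; rewrite -(ger0_norm (ltW rho0_gt0)) -sqrtr_sqr ler_wsqrtr//.
by rewrite ler_pdivrMr ?mulr_gt0// mulrC.
Qed.

Lemma delta_le t : 0 < t -> t <= t0 -> 0 <= delta t <= 1 / 2.
Proof.
move=> tp tt0; have Cmu : 0 <= C / mu by rewrite divr_ge0// ltW.
apply/andP; split; first by rewrite mulr_ge0 ?sqrtr_ge0.
apply: le_trans (_ : C / mu * (mu / (2 * C)) <= _).
  apply: ler_wpM2l => //.
  by apply: le_trans (sqrt_le_rho0 tp tt0) _; rewrite /rho0 ge_min lexx orbT.
by rewrite le_eqVlt; apply/orP; left; apply/eqP; field; rewrite !gt_eqF.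
Qed.

Lemma Q_rescaled om : Q (Z om) = n%:R * (2^-1 * qform H (X om - x0)).
Proof. by rewrite /Q /Z qformZ sqr_sqrtr ?ltW//; ring. Qed.

Lemma F_near_Q t om : 0 < t -> t <= t0 ->
  n%:R * mu * enorm (X om - x0) ^+ 2 < t ->
  `|F om - Q (Z om)| <= delta t * t.
Proof.
move=> tp tt0; set v := X om - x0 => vt.
have nmu : 0 < n%:R * mu by rewrite mulr_gt0.
have vrho : enorm v ^+ 2 < t / (n%:R * mu) by rewrite ltr_pdivlMr// mulrC.
set rho := Num.sqrt (t / (n%:R * mu)).
have rhoE : rho ^+ 2 = t / (n%:R * mu) by rewrite sqr_sqrtr// divr_ge0// ltW.
have v_rho : enorm v < rho.
  by rewrite -(@ltr_pXn2r _ 2)// ?nnegrE ?enorm_ge0 ?sqrtr_ge0// rhoE.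
have vr : enorm v < r.
  apply: lt_le_trans v_rho _; apply: le_trans (sqrt_le_rho0 tp tt0) _.
  by rewrite /rho0 ge_min lexx.
have := f_exp vr; rewrite (addrC x0) subrK => fe.
rewrite Q_rescaled -/v /F -!mulrBr normrM (gtr0_norm n0).
apply: le_trans (ler_wpM2l (ltW n0) fe) _.
have -> : delta t * t = n%:R * (C * rho ^+ 3).
  rewrite /delta -/rho; have -> : rho ^+ 3 = rho * rho ^+ 2 by rewrite exprS.
  by rewrite rhoE; field; rewrite !gt_eqF.
rewrite ler_pM2l// ler_pM2l// lerXn2r// ?nnegrE ?enorm_ge0 ?sqrtr_ge0//.
exact: ltW.
Qed.

(** Both [F] and [Q (Z om)] dominate the same multiple of the squared distance, so either one being
    below [t] localises the estimator. Each inclusion of the sandwich needs one of the two. *)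
Lemma F_ge om : n%:R * mu * enorm (X om - x0) ^+ 2 <= F om.
Proof.
by rewrite /F -mulrBr -mulrA ler_pM2l//; apply: f_growth; exact: XTheta.
Qed.

Lemma Q_rescaled_ge om : n%:R * mu * enorm (X om - x0) ^+ 2 <= Q (Z om).
Proof. by rewrite Q_rescaled -mulrA ler_pM2l//; have := H_ge (X om - x0); lra. Qed.

Lemma pF_bounds t : 0 < t -> t <= t0 ->
  pG (t * (1 + delta t)) - e <= pF t <= pG (t * (1 - delta t)) + e.
Proof.
move=> tp tt0.
have mQZ : measurable_fun setT (fun om => Q (Z om)).
  apply: measurable_funM; first exact: measurable_cst.
  by apply: (measurableT_comp (@measurable_borel_qform R q H)); exact: measurable_Z.
have /andP[dl0 dl1] := delta_le tp tt0.
have dt0 : 0 <= delta t * t by rewrite mulr_ge0// ltW.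
apply/andP; split.
- apply: le_trans (_ : fine (Pr [set om | t * (1 + delta t) <= Q (Z om)]) <= _).
    by have := berry_esseen_Q (t * (1 + delta t)); rewrite ler_norml => /andP[? _]; lra.
  apply: le_fine_probability; try exact: measurable_ge.
    by apply: measurable_ge; exact: measurable_F.
  move=> om /= h; rewrite leNgt; apply/negP => Ft.
  have := F_near_Q tp tt0 (le_lt_trans (F_ge om) Ft).
  by rewrite ler_norml => /andP[? _]; lra.
- apply: le_trans (_ : fine (Pr [set om | t * (1 - delta t) <= Q (Z om)]) <= _); last first.
    by have := berry_esseen_Q (t * (1 - delta t)); rewrite ler_norml => /andP[_ ?]; lra.
  apply: le_fine_probability; try exact: measurable_ge.
    by apply: measurable_ge; exact: measurable_F.
  move=> om /= h; rewrite leNgt; apply/negP => Qt.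
  have Qt' : Q (Z om) < t by apply: lt_le_trans Qt _; lra.
  have := F_near_Q tp tt0 (le_lt_trans (Q_rescaled_ge om) Qt').
  by rewrite ler_norml => /andP[_ ?]; lra.
Qed.

(** [K1] comes from the shell below level [t0], [K2] from the Gaussian tail at [t0]. *)
Let K1 := 24 * (C / mu) * Num.sqrt (24 * b / mu).
Let K2 := Num.sqrt (12 * b / (mu * rho0 ^+ 2)).

Lemma pG_anti t t' : t <= t' -> pG t' <= pG t.
Proof.
move=> tt'; apply: le_fine_probability; try exact/measurable_ge/measurable_GY.
by move=> om /=; exact: le_trans.
Qed.

Lemma pF_anti t t' : t <= t' -> pF t' <= pF t.
Proof.
move=> tt'; apply: le_fine_probability; try exact/measurable_ge/measurable_F.
by move=> om /=; exact: le_trans.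
Qed.

(** As [delta t] is at most 1/2, the ratio of the two levels exceeds 1 by at most [4 * delta t], and
    the lower level is at least [t / 2]. The factor [Num.sqrt t] in [delta t] then cancels against
    the one in the denominator of the tail. *)
Lemma shell_le t : 0 < t -> t <= t0 ->
  pG (t * (1 - delta t)) <= pG (t * (1 + delta t))
    + K1 * (Num.sqrt n%:R)^-1 * q%:R `^ (9 / 4).
Proof.
move=> tp tt0; have /andP[d0 d1] := delta_le tp tt0.
set dl := delta t in d0 d1 *.
have t1p : 0 < t * (1 - dl) by rewrite mulr_gt0//; lra.
have t12 : t * (1 - dl) <= t * (1 + dl) by rewrite ler_pM2l//; lra.
have hom s y : 2^-1 * qform (M *m H *m M) (s *: y) =
    s ^+ 2 * (2^-1 * qform (M *m H *m M) y) by rewrite qformZ; ring.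
apply: le_trans (std_gaussian_shell_le gY q_gt0 measurable_G hom b_gt0 G_le t1p t12) _.
rewrite lerD2l ler_wpM2r ?powR_ge0//.
set S := Num.sqrt (24 * b / t).
have S1 : Num.sqrt (12 * b / (t * (1 - dl))) <= S.
  rewrite ler_wsqrtr// ler_pdivrMr//.
  rewrite (_ : 24 * b / t * (t * (1 - dl)) = 12 * b * (2 * (1 - dl))); last first.
    by field; rewrite gt_eqF.
  have b12 : 0 <= 12 * b by rewrite mulr_ge0// ltW.
  by rewrite ler_peMr//; lra.
have S2 : t * (1 + dl) / (t * (1 - dl)) - 1 <= 4 * dl.
  rewrite lerBlDr ler_pdivrMr//.
  have : 0 <= t * (dl * (2 - 4 * dl)) by apply: mulr_ge0; [exact: ltW|apply: mulr_ge0 => //; lra].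
  nra.
have S20 : 0 <= t * (1 + dl) / (t * (1 - dl)) - 1.
  by rewrite subr_ge0 ler_pdivlMr// mul1r.
apply: le_trans (_ : 6 * (4 * dl) * S <= _).
  apply: ler_pM => //; rewrite ?mulr_ge0 ?sqrtr_ge0//.
  by rewrite ler_pM2l.
have nmu : 0 < n%:R * mu by rewrite mulr_gt0.
have -> : 6 * (4 * dl) * S =
    24 * (C / mu) * (Num.sqrt (t / (n%:R * mu)) * S) by rewrite /dl /delta; ring.
have k0 : 0 <= 24 * (C / mu) by rewrite mulr_ge0// divr_ge0// ltW.
rewrite /K1 -[leRHS]mulrA; apply: ler_wpM2l => //.
have tn : 0 <= t / (n%:R * mu) by rewrite divr_ge0// ltW.
have bm : 0 <= 24 * b / mu by rewrite divr_ge0 ?mulr_ge0// ltW.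
rewrite /S -sqrtrM// -sqrtrV ?(ltW n0)// -sqrtrM//.
rewrite ler_wsqrtr// le_eqVlt; apply/orP; left; apply/eqP.
by field; rewrite !gt_eqF.
Qed.

(** A probability bounded by [w] is also bounded by [Num.sqrt w]; this yields the n^(-1/2) rate,
    with q^(5/4) relaxed to q^(9/4). *)
Lemma pG_t0_le : pG t0 <= K2 * (Num.sqrt n%:R)^-1 * q%:R `^ (9 / 4).
Proof.
have q0 : 0 < q%:R :> R by rewrite ltr0n.
have q1 : 1 <= q%:R :> R by rewrite ler1n.
pose w := 12 * q%:R `^ (3 / 2) / (t0 / (b * q%:R)).
have bq : 0 < b * q%:R by rewrite mulr_gt0.
have pw : pG t0 <= w.
  apply: le_trans (std_gaussian_sumsq_tail gY (divr_gt0 t0_gt0 bq) q_gt0).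
  apply: le_fine_probability.
  - exact/measurable_ge/measurable_GY.
  - apply: measurable_ge; apply: measurableT_comp (@measurable_borel_sumsq R q) _.
    exact: gY.1.
  move=> om /= h; rewrite ler_pdivrMr// mulrC.
  exact: le_trans h (G_le _).
have p1 : pG t0 <= 1 by exact/fine_probability_le1/measurable_ge/measurable_GY.
have p0 : 0 <= pG t0 by exact: fine_probability_ge0.
have ps : pG t0 <= Num.sqrt w.
  rewrite -(ger0_norm p0) -sqrtr_sqr ler_wsqrtr// (le_trans _ pw)//.
  by rewrite expr2 ler_piMr.
apply: le_trans ps _.
have -> : w = 12 * b / (mu * rho0 ^+ 2) * n%:R^-1 * (q%:R `^ (5 / 4)) ^+ 2.
  rewrite /w /t0 -powR_mulrn ?powR_ge0// -powRrM.
  have -> : 5 / 4 * 2%:R = 3 / 2 + 1 :> R by field.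
  rewrite powRD ?implybE ?gt_eqF ?orbT// powRr1 ?(ltW q0)//.
  by field; rewrite !gt_eqF.
have c0 : 0 <= 12 * b / (mu * rho0 ^+ 2).
  by rewrite divr_ge0 ?mulr_ge0 ?sqr_ge0// ltW.
have cn0 : 0 <= 12 * b / (mu * rho0 ^+ 2) * n%:R^-1.
  by apply: mulr_ge0 => //; rewrite invr_ge0 ltW.
rewrite (sqrtrM _ cn0) (sqrtrM _ c0) sqrtr_sqr.
rewrite (ger0_norm (powR_ge0 _ _)) -/K2 sqrtrV ?(ltW n0)//.
apply: ler_wpM2l; first by rewrite mulr_ge0 ?sqrtr_ge0// invr_ge0 sqrtr_ge0.
by rewrite ler_powR//; lra.
Qed.

(** Above [t0] both tails are at most their values at [t0], which are close to each other by the
    case already treated and small by [pG_t0_le]. *)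
Lemma excess_risk_comparison t : 0 < t ->
  `|pF t - pG t| <= e + (K1 + K2) * (Num.sqrt n%:R)^-1 * q%:R `^ (9 / 4).
Proof.
move=> tp.
have N0 : 0 <= (Num.sqrt n%:R)^-1 * q%:R `^ (9 / 4) :> R.
  by apply: mulr_ge0; [rewrite invr_ge0 ltW|exact: powR_ge0].
have K10 : 0 <= K1.
  by rewrite /K1 mulr_ge0 ?sqrtr_ge0// mulr_ge0// divr_ge0// ltW.
have K20 : 0 <= K2 by exact: sqrtr_ge0.
set a : R := (Num.sqrt n%:R)^-1 * q%:R `^ (9 / 4) in N0.
have -> : (K1 + K2) * (Num.sqrt n%:R)^-1 * q%:R `^ (9 / 4) = K1 * a + K2 * a.
  by rewrite /a; ring.
have A1 : 0 <= K1 * a by exact: mulr_ge0.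
have A2 : 0 <= K2 * a by exact: mulr_ge0.
have near s : 0 < s -> s <= t0 -> `|pF s - pG s| <= e + K1 * a.
  move=> sp st; have /andP[b1 b2] := pF_bounds sp st.
  have := shell_le sp st; rewrite -mulrA -/a => sh.
  have /andP[d0 d1] := delta_le sp st.
  have g1 : pG (s * (1 + delta s)) <= pG s by apply: pG_anti; nra.
  have g2 : pG s <= pG (s * (1 - delta s)) by apply: pG_anti; nra.
  by rewrite ler_norml; apply/andP; split; lra.
have [tt0|t0t] := leP t t0; first by apply: le_trans (near t tp tt0) _; lra.
have f1 := pF_anti (ltW t0t); have f2 := pG_anti (ltW t0t).
have f3 : 0 <= pF t by exact: fine_probability_ge0.
have f4 : 0 <= pG t by exact: fine_probability_ge0.
have e0 := le_trans (normr_ge0 _) (berry_esseen_Q t).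
have g0 := pG_t0_le; rewrite -mulrA -/a in g0.
have := near t0 t0_gt0 (lexx _); rewrite !ler_norml => /andP[h1 h2].
by apply/andP; split; lra.
Qed.

End Comparison.

(** * From the cost to its expectation *)

(** Pathwise, the third difference is the Taylor remainder, at most [K z * enorm v ^+ 3], plus an
    error of at most twice that; hence the factor 3. As a combination of four values it can be
    integrated term by term. *)
Lemma third_difference_expectation (R : realType) d (T : measurableType d)
    (P : probability T R) q (m : 'cV[R]_q -> T -> R) (x : 'cV[R]_q)
    (K : T -> R) (r c h : R) (v : 'cV[R]_q) :
  (forall t, enorm (t - x) < r -> P.-integrable setT (EFin \o m t)) ->
  (forall t z, enorm (t - x) < r ->
     differentiable (m ^~ z) t /\ differentiable (grad (m ^~ z)) t) ->
  (forall t z, enorm (t - x) < r ->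
     opnorm (hess (m ^~ z) t - hess (m ^~ z) x) <= K z * enorm (t - x)) ->
  measurable_fun setT K -> (forall z, 0 <= K z) -> 0 <= c ->
  (\int[P]_z (K z)%:E <= c%:E)%E ->
  enorm v < r -> 0 < h -> h <= 1 ->
  `|third_difference (fun t => fine 'E_P[m t]) x v h| <=
    3 * c * enorm v ^+ 3.
Proof.
move=> mi md mL mK K0 c0 Kc vr h0 h1.
have ball u : enorm u < r -> enorm (x + u - x) < r by rewrite addrC addKr.
have xr : enorm (x - x) < r.
  by rewrite subrr enorm0 (le_lt_trans _ vr)// enorm_ge0.
have hv : enorm (h *: v) < r by apply: enorm_line_lt => //; rewrite gtr0_norm.
have hv' : enorm (- (h *: v)) < r.
  by rewrite -scaleNr; apply: enorm_line_lt => //; rewrite normrN gtr0_norm.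
have tay z u : enorm u < r ->
    `|m (x + u) z - m x z - dot u (grad (m ^~ z) x)^T
      - 2^-1 * qform (hess (m ^~ z) x) u| <= K z * enorm u ^+ 3.
  move=> ur; have seg s : 0 <= s <= 1 -> enorm (x + s *: u - x) < r.
    move=> /andP[s0 s1]; apply: ball; apply: enorm_line_lt => //.
    by rewrite ger0_norm.
  apply: (@taylor2 _ _ (m ^~ z)) => s s01; first exact/md/seg.
  apply: le_trans (mL _ z (seg s s01)) _.
  by rewrite (addrC x) addrK enormZ ger0_norm//; case/andP: s01.
have pt z : `|third_difference (m ^~ z) x v h| <= 3 * enorm v ^+ 3 * K z.
  have := third_difference_le (g := m ^~ z) (v := v) h0 h1 (tay z _ hv) (tay z _ hv').
  have := tay z _ vr.
  set a := third_difference _ _ _ _; set b := _ - _ - _ - _ => hb hab.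
  have e3 : 0 <= K z * enorm v ^+ 3 by rewrite mulr_ge0// exprn_ge0// enorm_ge0.
  have := ler_normD (a - b) b; rewrite subrK.
  have : 2 * K z * enorm v ^+ 3 * h <= 2 * (K z * enorm v ^+ 3).
    have -> : 2 * K z * enorm v ^+ 3 * h = 2 * (K z * enorm v ^+ 3) * h by ring.
    by rewrite ler_piMr// mulr_ge0.
  lra.
pose p (i : 'I_4) := nth x [:: x + v; x; x + h *: v; x - h *: v] i.
pose a (i : 'I_4) := nth 0 [:: 1; h ^- 2 - 1; - (2 * h)^-1 - (2 * h ^+ 2)^-1;
  (2 * h)^-1 - (2 * h ^+ 2)^-1] i.
have tdE (g : 'cV[R]_q -> R) : third_difference g x v h = \sum_i a i * g (p i).
  rewrite !big_ord_recl big_ord0 /a /p /= /third_difference addr0.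
  by field; rewrite gt_eqF.
have unlockE t : ('E_P[m t])%E = (\int[P]_z (m t z)%:E)%E by rewrite unlock.
rewrite tdE; under eq_bigr do rewrite unlockE.
have e3 : 0 <= 3 * enorm v ^+ 3 by rewrite mulr_ge0// exprn_ge0// enorm_ge0.
apply: (normr_lincomb_integral_le (K := fun z => 3 * enorm v ^+ 3 * K z)).
- move=> i; apply: mi; rewrite /p.
  by case: i => -[|[|[|[|//]]]] i4 /=; rewrite ?xr//; apply: ball.
- by apply: measurable_funM => //; exact: measurable_cst.
- by move=> z; rewrite mulr_ge0.
- by move=> z; rewrite -(tdE (m ^~ z)).
under eq_integral do rewrite EFinM.
rewrite ge0_integralZl//; last 2 first.
- exact/measurable_EFinP.
- by move=> z _; rewrite lee_fin.
have -> : 3 * c * enorm v ^+ 3 = 3 * enorm v ^+ 3 * c by ring.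
by rewrite [leRHS]EFinM lee_wpmul2l// lee_fin.
Qed.

(** Continuity on the open set [D] makes the part in [D] of the preimage of an open interval open,
    and [X] never leaves [D]. *)
Lemma measurable_comp_open (R : realType) d (T : measurableType d) q
    (X : T -> borel R q) (f : 'cV[R]_q -> R) (D : set 'cV[R]_q) :
  measurable_fun setT X -> open D -> (forall t, D (X t)) ->
  (forall x, D x -> differentiable f x) ->
  measurable_fun setT (fun t => f (X t)).
Proof.
move=> mX oD DX df.
apply: (measurability _ (RGenOpens.measurableE R)).
move=> _ [_ [a [b ->]] <-]; rewrite setTI.
have oU : open (D `&` f @^-1` `]a, b[%classic).
  rewrite openE => x [Dx fx]; apply: filterI; first exact: open_nbhs_nbhs.
  apply: (differentiable_continuous (df x Dx)).
  by apply: open_nbhs_nbhs; split => //; exact: interval_open.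
have : measurable (D `&` f @^-1` `]a, b[%classic : set (borel R q)).
  exact: sub_sigma_algebra.
move=> /(mX measurableT); rewrite setTI.
rewrite [X in measurable X -> _](_ : _ = (fun t => f (X t)) @^-1` `]a, b[%classic)//.
by apply/seteqP; split => t /= => [[]|].
Qed.

(** * Signs of constants and the degenerate case *)

Lemma berry_esseen_ge0 (R : realType) q d d' (T : measurableType d)
    (T' : measurableType d') (Pr : probability T R) (Pr' : probability T' R)
    (that : nat -> T -> 'cV[R]_q) (tstar : 'cV[R]_q) (M : 'M[R]_q)
    (Y : T' -> 'cV[R]_q) (C : R) :
  (0 < q)%N -> berry_esseen Pr Pr' that tstar M Y C -> 0 <= C.
Proof.
move=> q0 /(_ 1%N set0 isT measurable0) BE.
have : 0 <= be_error C 1 q.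
  by apply: le_trans (BE _) => // x y l; rewrite inE.
by rewrite /be_error !pmulr_lge0// powR_gt0 ?ltr0n.
Qed.

(* A vanishing Berry-Esseen constant would make [M *m Y], which is unbounded
   unless [M = 0], equidistributed with a bounded variable. *)
Lemma berry_esseen0_degenerate (R : realType) q d d' (T : measurableType d)
    (T' : measurableType d') (Pr : probability T R) (Pr' : probability T' R)
    (that : nat -> T -> 'cV[R]_q) (tstar : 'cV[R]_q) (M : 'M[R]_q)
    (Y : T' -> 'cV[R]_q) (Theta : set 'cV[R]_q) :
  berry_esseen Pr Pr' that tstar M Y 0 -> std_gaussian Pr' Y ->
  bounded_set Theta -> (forall om, Theta (that 1%N om)) -> M = 0.
Proof.
move=> BE gY [B [_ bT]] thatT; apply/matrixP => i j; rewrite [RHS]mxE.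
apply/eqP; apply: contrapT => /negP Mij.
have {}bT t : Theta t -> `|t i 0| <= `|B| + 1.
  move=> /(bT (`|B| + 1)) h; apply: le_trans (h _).
    rewrite [leRHS]mx_normrE.
    exact: (le_bigmax _ (fun ij => `|t ij.1 ij.2|) (i, 0)).
  by rewrite (le_lt_trans (ler_norm B))// ltrDl.
(* At [n = 1] there is no rescaling, so coordinate [i] of the centred estimator never exceeds [c]. A
   zero error then gives the half-space at level [c] full probability under the Gaussian law as
   well. *)
pose c := `|B| + 1 + `|tstar i 0|.
pose A : set 'cV[R]_q := [set x | x i 0 <= c].
have mA : measurable (A : set (borel R q)).
  rewrite [X in measurable X](_ : _ = [set x : borel R q | - c <= - x i 0]).
    apply: measurable_ge; apply: measurableT_comp => //.
    exact: measurable_borel_coord.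
  by apply/seteqP; split => x /=; rewrite /A /= lerN2.
have cA : convex_set (A : set (convex_lmodType 'cV[R]_q)).
  apply: convex_set_lmod => x y s s0 s1; rewrite /A /= !mxE => xc yc.
  have : s * x i 0 <= s * c by rewrite ler_wpM2l.
  have : (1 - s) * y i 0 <= (1 - s) * c by rewrite ler_wpM2l// subr_ge0.
  lra.
have := BE 1%N A isT mA cA; rewrite /be_error !mul0r normr_le0 subr_eq0 => /eqP.
rewrite (_ : [set om | A (Num.sqrt 1%:R *: (that 1%N om - tstar))] = setT); last first.
  apply/seteqP; split => om // _; rewrite /A /= sqrtr1 scale1r !mxE.
  have := bT _ (thatT om); have := ler_norm (that 1%N om i 0).
  by have := ler_norm (- tstar i 0); rewrite normrN /c; lra.
rewrite probability_setT/= => P1.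
have := @std_gaussian_linear_unbounded _ _ _ Pr' _ Y (M i) j c gY Mij.
rewrite (_ : [set w | _] = [set om | A (M *m Y om)]) -?P1 ?ltxx//.
by apply/seteqP; split => w /=; rewrite /A /= mxE.
Qed.

Lemma be_errorE (R : realType) (C : R) n q :
  be_error C n q = C * ((Num.sqrt n%:R)^-1 * q%:R `^ (9 / 4)).
Proof.
by rewrite /be_error powRN div1r powR12_sqrt ?ler0n// -mulrA (mulrC (_ `^ _)).
Qed.

(** Two distinct points of the ball suffice, which requires positive dimension. The sign makes the
    term carrying [L1] in the final bound nonnegative. *)
Lemma lipschitz_constant_ge0 (R : realType) q (f : 'cV[R]_q -> R)
    (x : 'cV[R]_q) (r L : R) : (0 < q)%N -> 0 < r ->
  (forall t1 t2, enorm (t1 - x) < r -> enorm (t2 - x) < r ->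
     opnorm (hess f t1 - hess f t2) <= L * enorm (t1 - t2)) -> 0 <= L.
Proof.
move=> q0 r0 fL; pose v : 'cV[R]_q := const_mx 1.
have v0 : 0 < enorm v.
  apply: lt_le_trans (coord_le_enorm v (Ordinal q0)).
  by rewrite mxE normr1.
pose s := r / (2 * enorm v).
have s0 : 0 < s by rewrite divr_gt0// mulr_gt0.
have sv : enorm (s *: v) = r / 2.
  by rewrite enormZ gtr0_norm// /s; field; rewrite gt_eqF.
have := fL (x + s *: v) x; rewrite subrr enorm0 addrC addKr sv => /(_ _ r0) h.
have {}h := le_trans (opnorm_ge0 _) (h _).
by have := h; rewrite pmulr_lge0 ?divr_gt0//; apply; rewrite ltr_pdivrMr//; lra.
Qed.

Lemma measurable_borel_set1 (R : realType) q (x : 'cV[R]_q) :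
  measurable ([set x] : set (borel R q)).
Proof.
rewrite [X in measurable X](_ : _ = [set y : borel R q | forall i, y i 0 = x i 0]).
  apply: measurable_forall_ord => i; rewrite -[X in measurable X]setTI.
  exact: (@measurable_borel_coord R q i measurableT [set x i 0]).
apply/seteqP; split => y /= => [-> //|yx].
by apply/matrixP => i j; rewrite ord1 yx.
Qed.

(** The convex set reduced to 0 has full probability under the limit law, so the estimator equals
    [tstar] almost surely. Then neither variable reaches [t > 0] with positive probability. *)
Lemma zero_berry_esseen_comparison (R : realType) q d d' (T : measurableType d)
    (T' : measurableType d') (Pr : probability T R) (Pr' : probability T' R)
    (that : nat -> T -> 'cV[R]_q) (tstar : 'cV[R]_q) (H : 'M[R]_q)
    (Y : T' -> 'cV[R]_q) (f : 'cV[R]_q -> R) n (t : R) :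
  (0 < n)%N -> 0 < t ->
  berry_esseen Pr Pr' that tstar 0 Y 0 ->
  measurable_fun setT (that n : T -> borel R q) ->
  measurable_fun setT (fun om => f (that n om)) ->
  `|fine (Pr [set om | t <= n%:R * f (that n om) - n%:R * f tstar])
    - fine (Pr' [set om | t <= 2^-1 * qform (0 *m H *m 0) (Y om)])| <= 0.
Proof.
move=> n0 t0 BE mX mf.
have m0 : measurable ([set 0] : set (borel R q)).
  exact: measurable_borel_set1.
have c0 : convex_set ([set 0] : set (convex_lmodType 'cV[R]_q)).
  by apply: convex_set_lmod => x y s _ _ /= -> ->; rewrite !scaler0 addr0.
have := BE n [set 0] n0 m0 c0; rewrite /be_error !mul0r normr_le0 subr_eq0.
rewrite (_ : [set om | [set 0] (0 *m Y om)] = setT); last first.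
  by apply/seteqP; split => om // _; rewrite /= mul0mx.
rewrite probability_setT/= => /eqP P1.
have sn0 : Num.sqrt n%:R != 0 :> R by rewrite gt_eqF// sqrtr_gt0 ltr0n.
have E0 : [set om | [set 0] (Num.sqrt n%:R *: (that n om - tstar))] =
    [set om | that n om = tstar].
  apply/seteqP; split => om /=; last by move->; rewrite subrr scaler0.
  by move/eqP; rewrite scaler_eq0 (negbTE sn0) subr_eq0 => /eqP.
rewrite E0 in P1.
rewrite (_ : [set om | t <= 2^-1 * _] = set0); last first.
  apply/seteqP; split => om //=; rewrite /qform !mulmx0 mxE big1 ?mulr0.
    by rewrite leNgt t0.
  by move=> i _; rewrite !mxE mul0r.
rewrite measure0 subr0 ger0_norm ?fine_probability_ge0//.
have mF : measurable [set om | t <= n%:R * f (that n om) - n%:R * f tstar].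
  apply: measurable_ge; apply: measurable_funB; last exact: measurable_cst.
  by apply: measurable_funM => //; exact: measurable_cst.
have mE : measurable [set om | that n om = tstar].
  rewrite -[X in measurable X]setTI.
  exact: (mX measurableT _ (measurable_borel_set1 tstar)).
apply: le_trans (le_fine_probability _ mF (measurableC mE) _) _.
  by move=> om /= h e; move: h; rewrite e subrr leNgt t0.
by rewrite probability_setC// fineB ?fin_num_measure//= P1 subrr.
Qed.

(** * The bound with uniform constants *)

Unset Implicit Arguments.
Set Strict Implicit.

Theorem proposition2 (R : realType) (mu c1 c2 c3 c4 l1 l2 CIEO r : R)
    (r_gt0 : 0 < r) :
  exists K : R, 0 < K /\
  forall (p q d : nat)
    (Omega : set 'cV[R]_p) (Theta : set 'cV[R]_q) (Z : set 'cV[R]_d) (z0 : Z)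
    (c : 'cV[R]_p -> borel_on z0 -> R)
    (P : probability (borel_on z0) R) (Pth : 'cV[R]_q -> probability (borel_on z0) R)
    (w : 'cV[R]_q -> 'cV[R]_p) (tstar : 'cV[R]_q)
    (dT : measure_display) (T : measurableType dT) (Pr : probability T R)
    (z : nat -> T -> borel_on z0) (that : nat -> T -> 'cV[R]_q)
    (dT' : measure_display) (T' : measurableType dT') (Pr' : probability T' R)
    (Y0 : T' -> 'cV[R]_q)
    (L1 : R) (M1 : 'M[R]_q) (lam : seq R),
  let v0 := expected_cost P c in
  let m := fun (t : 'cV[R]_q) (x : borel_on z0) => c (w t) x in
  let H := hess (fun t => v0 (w t)) tstar in
  let G := fun om : T' => 2^-1 * qform (M1 *m H *m M1) (Y0 om) in
  open Omega -> open Theta ->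
  (forall x, Omega x -> measurable_fun setT (c x)) ->
  (forall t, Theta t -> P.-integrable setT (EFin \o c (w t))) ->
  (forall t, Theta t ->
    argmin_on Omega (fun x => 'E_(Pth t)[c x]%E) (w t)) ->
  argmin_on Theta (fun t => (v0 (w t))%:E) tstar ->
  (* the constant K below may depend on the radius of a ball around tstar
     contained in Theta; such a ball exists since Theta is open *)
  (forall t, enorm (t - tstar) < r -> Theta t) ->
  iid Pr P z ->
  (forall n, (0 < n)%N ->
    measurable_fun setT (that n : T -> borel R q) /\
    forall om, argmin_on Theta
      (fun t => (empirical_cost z c n (w t) om)%:E) (that n om)) ->
  std_gaussian Pr' Y0 ->
  is_psd_sqrt M1
    (invmx H *m cov_mx P (fun x => grad (m ^~ x) tstar) *m invmx H) ->
  is_spectrum (2^-1 *: (M1 *m H *m M1)) lam ->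
  lipschitz_hessian Theta (fun t => v0 (w t)) L1 ->
  consistency Pr Theta (fun n om t => empirical_cost z c n (w t) om)
    (fun t => v0 (w t)) tstar ->
  regularity P Theta m tstar mu c1 c2 c3 c4 l1 l2 ->
  berry_esseen Pr Pr' that tstar M1 Y0 CIEO ->
  exists D : nat -> R,
  [/\ forall n (t : R), (0 < n)%N -> 0 < t ->
        `|fine (Pr [set om | t <= n%:R * v0 (w (that n om))
                                  - n%:R * v0 (w tstar)])
          - fine (Pr' [set om | t <= G om])| <= D n,
      q = 1%N -> forall n, (0 < n)%N ->
        D n <= K * ((Num.sqrt lam`_0)^-1 * L1 `^ (1 / 2)
                      * opnorm M1 `^ (3 / 2) * ln n%:R `^ (3 / 4)
                      * n%:R `^ (- (1 / 4))
                    + be_error CIEO n 1) &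
      (2 <= q)%N -> forall n, (0 < n)%N ->
        D n <= K * (be_error CIEO n q
                    + ((\sum_(0 <= i < q) lam`_i ^+ 2)
                        * (\sum_(1 <= i < q) lam`_i ^+ 2)) `^ (- (1 / 4))
                      * L1 * opnorm M1 ^+ 3 * q%:R `^ (3 / 2)
                      * ln n%:R `^ (3 / 2) * n%:R `^ (- (1 / 2)))].
Proof.
(* [1 + c2 ^+ 4] bounds the expectation of [K2], and 3 is the factor lost by the third difference.
   Then [b] is the trace bound [c4 ^+ 2] per dimension divided by [4 * mu], and [A] is the sum of
   the two constants of the fixed-sample comparison. *)
pose C0 := 3 * (1 + c2 ^+ 4).
pose b := c4 ^+ 2 / (4 * mu).
pose A := 24 * (C0 / mu) * Num.sqrt (24 * b / mu)
  + Num.sqrt (12 * b / (mu * Num.min r (mu / (2 * C0)) ^+ 2)).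
(* For [CIEO > 0] this gives [K * CIEO = CIEO + |A|]. For [CIEO = 0] the quotient is 0 by
   convention. Absolute values make [K] positive before any sign hypothesis is available. *)
pose K := 1 + `|A| / `|CIEO|.
have K1 : 1 <= K by rewrite lerDl divr_ge0.
have K0 : 0 < K by exact: lt_le_trans K1.
exists K; split=> // p q d Omega Theta Z z0 c P Pth w tstar dT T Pr z that dT' T'
  Pr' Y0 L1 M1 lam v0 m H G oOmega oTheta mc ic wmin tmin ballT izP thatP gY M1P
  _ [bTheta dTheta LTheta] _ reg BE.
pose f t := v0 (w t).
have mthat n : (0 < n)%N -> measurable_fun setT (that n : T -> borel R q).
  by move=> /thatP[].
have thatT n om : (0 < n)%N -> Theta (that n om).
  by move=> /thatP[_ /(_ om)[]].
have mf n : (0 < n)%N -> measurable_fun setT (fun om => f (that n om)).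
  move=> n0; apply: (measurable_comp_open (D := Theta)) => //; first exact: mthat.
    by move=> om; exact: thatT.
  by move=> t /dTheta[].
(* In dimension 0 both regimes of the bound are void, and 1 bounds the difference of two
   probabilities. *)
have [q0|q_gt0] := posnP q.
  exists (fun=> 1); split=> [n t n0 _|q1|q2].
  - have mF : measurable [set om | t <= n%:R * v0 (w (that n om)) - n%:R * v0 (w tstar)].
      apply: measurable_ge; apply: measurable_funB; last exact: measurable_cst.
      by apply: measurable_funM; [exact: measurable_cst|exact: mf].
    have mG : measurable [set om | t <= G om].
      apply: measurable_ge; apply: measurable_funM; first exact: measurable_cst.
      by apply: measurableT_comp (@measurable_borel_qform _ _ _) gY.1.
    have := fine_probability_le1 Pr mF; have := fine_probability_le1 Pr' mG.
    have := fine_probability_ge0 Pr [set om | t <= n%:R * v0 (w (that n om)) - n%:R * v0 (w tstar)].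
    have := fine_probability_ge0 Pr' [set om | t <= G om].
    by rewrite ler_norml => *; apply/andP; split; lra.
  - by rewrite q0 in q1.
  - by rewrite q0 in q2.
have [[mu0 _ c20 _ [c40 _ _]] dm [K1' [K2 [K3 [[_ mK2 _] Kge [_ LK2 _] regt]]]]
  growth [_ _ L4]] := reg.
have ballT' t : enorm (t - tstar) < r -> Theta t by exact: ballT.
have fdiff t : enorm (t - tstar) < r ->
    differentiable f t /\ differentiable (grad f) t.
  by move=> /ballT'/dTheta.
have flip t1 t2 : enorm (t1 - tstar) < r -> enorm (t2 - tstar) < r ->
    opnorm (hess f t1 - hess f t2) <= L1 * enorm (t1 - t2).
  by move=> /ballT' h1 /ballT' h2; exact: LTheta.
have L10 : 0 <= L1 by exact: (lipschitz_constant_ge0 q_gt0 r_gt0 flip).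
have fgrowth t : Theta t -> mu * enorm (t - tstar) ^+ 2 <= f t - f tstar.
  exact: growth.
have fgrowth' v : enorm v < r -> mu * enorm v ^+ 2 <= f (tstar + v) - f tstar.
  move=> vr; have := @fgrowth (tstar + v); rewrite (addrC tstar) addrK; apply.
  by apply: ballT; rewrite addrK.
have IK2 : (\int[P]_x (K2 x)%:E <= (1 + c2 ^+ 4)%:E)%E.
  apply: integral_le_of_pow4 => //; first exact: ltW.
  by move=> x; have [] := Kge x.
have c24 : 0 <= 1 + c2 ^+ 4 by rewrite addr_ge0// exprn_ge0// ltW.
have C0p : 0 < C0 by rewrite mulr_gt0// ltr_pwDl// exprn_ge0// ltW.
have bp : 0 < b by rewrite divr_gt0 ?exprn_gt0// mulr_gt0.
have fthird v h : enorm v < r -> 0 < h -> h <= 1 ->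
    `|third_difference f tstar v h| <= C0 * enorm v ^+ 3.
  apply: (third_difference_expectation (m := m) (K := K2)) => //.
  - by move=> t /ballT'; exact: ic.
  - by move=> t x /ballT' tT; exact: (dm x t tT).
  - by move=> t x /ballT' tT; have [] := regt t x tT.
  - by move=> x; have [] := Kge x.
have fexp := quadratic_expansion fdiff flip fgrowth' fthird mu0.
have Hge := qform_hess_ge r_gt0 fdiff flip fgrowth' fthird mu0.
have Hsym := hess_sym r_gt0 fdiff flip fgrowth' mu0.
have mm t : enorm (t - tstar) < r -> measurable_fun setT (m t).
  by move=> /ballT' tT; apply: mc; have [] := wmin t tT.
have tstarT : Theta tstar by apply: ballT; rewrite subrr enorm0.
have trc : \sum_i cov_mx P (fun x => grad (m ^~ x) tstar) i i <= c4 ^+ 2 * q%:R.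
  have c4q : 0 < c4 * Num.sqrt q%:R by rewrite mulr_gt0// sqrtr_gt0 ltr0n.
  apply: le_trans (cov_mx_trace_le c4q _ L4) _.
    move=> i; apply: (measurable_grad_coord (r := r)) => // x.
    exact: (dm x tstar tstarT).1.
  by rewrite exprMn sqr_sqrtr// ler0n.
have Gle y : 2^-1 * qform (M1 *m H *m M1) y <= b * q%:R * \sum_i y i 0 ^+ 2.
  apply: le_trans (half_qform_sandwich_le y mu0 Hge Hsym M1P trc) _.
  by rewrite /b [X in X * _ <= _]mulrAC.
have main n t : (0 < n)%N -> 0 < t ->
    `|fine (Pr [set om | t <= n%:R * f (that n om) - n%:R * f tstar])
      - fine (Pr' [set om | t <= G om])| <=
    be_error CIEO n q + A * ((Num.sqrt n%:R)^-1 * q%:R `^ (9 / 4)).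
  move=> n0 t0; have [[MT _] _] := M1P.
  have BEn B mB cB := BE n B n0 mB cB.
  have h := excess_risk_comparison q_gt0 n0 r_gt0 mu0 bp C0p gY MT
    (fun om => thatT n om n0) (mthat n n0) (mf n n0) fexp fgrowth Hge Gle BEn t0.
  by apply: le_trans h _; rewrite lerD2l [leRHS]mulrA.
have CIEO0 := berry_esseen_ge0 q_gt0 BE.
have be0 n : 0 <= be_error CIEO n q.
  rewrite be_errorE !mulr_ge0 ?powR_ge0// invr_ge0 sqrtr_ge0//.
pose D n := K * be_error CIEO n q.
have D_ok n t : (0 < n)%N -> 0 < t ->
    `|fine (Pr [set om | t <= n%:R * f (that n om) - n%:R * f tstar])
      - fine (Pr' [set om | t <= G om])| <= D n.
  move=> n0 t0; have [C0'|Cn] := eqVneq CIEO 0.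
    rewrite /D C0' /be_error !mul0r mulr0.
    have BE0 := BE; rewrite C0' in BE0.
    have M10 := berry_esseen0_degenerate BE0 gY bTheta (fun om => thatT 1%N om isT).
    rewrite M10 in BE0; rewrite /G M10.
    by apply: zero_berry_esseen_comparison => //; [exact: mthat|exact: mf].
  have Cp : 0 < CIEO by rewrite lt_neqAle eq_sym Cn.
  apply: le_trans (main n t n0 t0) _.
  rewrite /D /K [leRHS]mulrDl mul1r lerD2l be_errorE (gtr0_norm Cp) [leRHS]mulrA divfK//.
  by rewrite ler_wpM2r ?ler_norm// mulr_ge0 ?powR_ge0// invr_ge0 sqrtr_ge0.
exists D; split=> [n t n0 t0|q1 n n0|q2 n n0]; first exact: D_ok.
(* In both regimes the summand next to [be_error] is a product of nonnegative factors; for [q >= 2]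
   this rests on [0 <= L1]. *)
- rewrite /D ler_pM2l//.
  have -> : be_error CIEO n q = be_error CIEO n 1 by rewrite q1.
  by rewrite lerDr !mulr_ge0 ?powR_ge0// invr_ge0 sqrtr_ge0.
- rewrite /D ler_pM2l// lerDl.
  by rewrite !mulr_ge0 ?powR_ge0 ?exprn_ge0 ?opnorm_ge0.
Qed.
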